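(* Let $\omega$ be a concave modulus of continuity and write $$\eta = \lim_{t \to 0} \frac{\log\omega(t)}{\log t}$$ (this limit exists because $\omega$ is concave). Then: (i) If $\eta \geq 1$, then $\dim_{\mathrm{A}}^{\theta} G_f = 1$ for all $f \in C^\omega[0,1]$ and all $\theta \in (0,1)$. (ii) If $\eta < 1$, then a typical $f \in (c^\omega[0,1], \|\cdot\|_\omega)$ satisfies, for all $\theta\in(0,1)$ simultaneously, $$\dim_{\mathrm{A}}^{\theta} G_f = 2- \frac{\eta-\theta}{1-\theta} \quad \text{if } \theta \leq \eta, \qquad \dim_{\mathrm{A}}^{\theta} G_f = 2 \quad \text{if } \theta > \eta.$$ In particular, this holds in all little Hölder spaces, i.e. for $\omega(t)=t^\alpha$ with $\alpha\in(0,1)$, where $\eta = \alpha$.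
   Context: A modulus of continuity is a function $\omega:[0,1]\to[0,\infty]$ that is increasing (meaning non-decreasing), satisfies $\omega(t)>0$ for $t>0$, and $\lim_{t\to 0}\omega(t)=\omega(0)=0$. For $f:[0,1]\to\mathbb{R}$ put $[f]_\omega=\sup_{x,y\in[0,1],\,x\neq y}\frac{|f(x)-f(y)|}{\omega(|x-y|)}$ and $\|f\|_\omega=\|f\|_\infty+[f]_\omega$. Let $C^\omega[0,1]=\{f:[0,1]\to\mathbb{R} : [f]_\omega<\infty\}$, and let $c^\omega[0,1]$ (the little $\omega$-space) be the set of all $f\in C^\omega[0,1]$ with $\lim_{t\to0}\sup\{\frac{|f(x)-f(y)|}{\omega(|x-y|)} : x,y\in[0,1],\ x\neq y,\ |x-y|\leq t\}=0$. Both are complete metric spaces under $\|\cdot\|_\omega$. In a complete metric space, a set is meagre if it is a countable union of nowhere dense sets, and residual if its complement is meagre; a typical element has a property if the set of elements having it is residual. $G_f=\{(x,f(x)) : x\in[0,1]\}\subseteq\mathbb{R}^2$ is the graph of $f$. For non-empty $E\subseteq\mathbb{R}^d$ and $r>0$, $N_r(E)$ is the maximum number of pairwise disjoint closed balls of radius $r$ with centres in $E$. $B^o(x,R)$ is the open ball of radius $R$ centred at $x$. For $\theta\in(0,1)$ the Assouad spectrum of a non-empty $F\subseteq\mathbb{R}^d$ is $$\dim_{\mathrm{A}}^{\theta}F=\inf\{\beta : \exists\, C>0 \text{ such that for all } 0<r<1 \text{ and } x\in F,\ N_r(B^o(x,r^\theta)\cap F)\leq C(r^\theta/r)^\beta\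}.$$
   Formalization: The existence of the limit η is assumed rather than derived from concavity, because it can fail: for some concave moduli of continuity log ω(t)/log t oscillates as t → 0, and then η is undefined. *)

(* Defs.v *)
From HB Require Import structures.
From mathcomp Require Import all_boot all_order all_algebra.
From mathcomp Require Import interval_inference ring lra.
From mathcomp Require Import all_classical all_reals all_analysis.

Set Implicit Arguments.
Unset Strict Implicit.
Unset Printing Implicit Defensive.

Import Order.TTheory GRing.Theory Num.Theory.
Import numFieldNormedType.Exports.

Local Open Scope classical_set_scope.
Local Open Scope ring_scope.

Definition nowhere_dense (T : topologicalType) (A : set T) : Prop :=
  (closure A)° = set0.

Definition meagre (T : topologicalType) (A : set T) : Prop :=
  exists F : nat -> set T,
    (forall n, nowhere_dense (F n)) /\ A = \bigcup_n F n.

Definition residual (T : topologicalType) (A : set T) : Prop := meagre (~` A).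

Definition typical (T : topologicalType) (P : T -> Prop) : Prop :=
  residual [set x | P x].

(* Assouad spectrum; the library norm on ['rV[R]_d] is the sup norm, so the
   Euclidean distance is introduced here. *)

Section assouad_spectrum.
Context {R : realType} {d : nat}.
Implicit Types (x y : 'rV[R]_d) (r theta : R) (E F : set 'rV[R]_d).

Definition edist x y : R := Num.sqrt (\sum_(i < d) (x 0 i - y 0 i) ^+ 2).

Definition open_eball x r : set 'rV[R]_d := [set y | edist x y < r].

Definition closed_eball x r : set 'rV[R]_d := [set y | edist x y <= r].

(* Supremum in [\bar R] of the cardinalities of the [r]-packings; it is [+oo]
   when these are unbounded. *)
Definition packing_number r E : \bar R :=
  ereal_sup [set (n%:R)%:E | n in [set n : nat | exists c : 'I_n -> 'rV[R]_d,
    (forall i, E (c i)) /\ trivIset setT (fun i => closed_eball (c i) r)]].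

Definition assouad_spectrum theta F : \bar R :=
  ereal_inf [set beta%:E | beta in [set beta : R | exists C : R, 0 < C /\
    forall r, 0 < r < 1 -> forall x, F x ->
      (packing_number r (open_eball x (r `^ theta) `&` F)
         <= (C * (r `^ theta / r) `^ beta)%:E)%E]].

End assouad_spectrum.

Definition graph (R : realType) (f : {i01 R} -> R) : set 'rV[R]_2 :=
  [set \row_(i < 2) [:: x%:num; f x]`_i | x in [set: {i01 R}]].

(* Moduli of continuity are total functions on [R] of which only the values on
   the interval from 0 to 1 are ever constrained or used. *)

Record is_modulus (R : realType) (omega : R -> \bar R) : Prop := IsModulus {
  modulus0 : omega 0 = 0%E ;
  modulus_gt0 : forall t, 0 < t <= 1 -> (0 < omega t)%E ;
  modulus_nd : forall s t, 0 <= s -> s <= t -> t <= 1 ->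
    (omega s <= omega t)%E ;
  modulus_cvg0 : omega t @[t --> 0^'+] --> 0%E }.

Record modulus (R : realType) := Modulus {
  modulus_fun :> R -> \bar R ;
  modulusP : is_modulus modulus_fun }.

Definition concave_on01 (R : realType) (omega : R -> \bar R) : Prop :=
  forall s t k : R, 0 <= s <= 1 -> 0 <= t <= 1 -> 0 <= k <= 1 ->
    (k%:E * omega s + (1 - k)%:E * omega t
       <= omega (k * s + (1 - k) * t)%R)%E.

(* [fine] only discards values [+oo], which are absent for small [t].  The limit
   of this ratio at [0] lies in the unit interval when it exists, but concavity
   alone does not make it exist: it may oscillate. *)
Definition log_ratio (R : realType) (omega : R -> \bar R) (t : R) : R :=
  ln (fine (omega t)) / ln t.

Section omega_spaces.
Context {R : realType}.
Implicit Types (omega : R -> \bar R) (f g h : {i01 R} -> R).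

(* Division in [\bar R]: the quotient is 0 where [omega] is [+oo]. *)
Definition omega_quot omega f (x y : {i01 R}) : \bar R :=
  ((`|f x - f y|%R)%:E / omega `|x%:num - y%:num|%R)%E.

Definition omega_seminorm omega f : \bar R :=
  ereal_sup [set omega_quot omega f p.1 p.2 |
    p in [set p : {i01 R} * {i01 R} | p.1 <> p.2]].

Definition sup_norm f : \bar R :=
  ereal_sup [set (`|f x|)%:E | x in [set: {i01 R}]].

Definition omega_norm omega f : \bar R :=
  (sup_norm f + omega_seminorm omega f)%E.

Definition C_omega omega : set ({i01 R} -> R) :=
  [set f | (omega_seminorm omega f < +oo)%E].

Definition omega_osc omega f (t : R) : \bar R :=
  ereal_sup [set omega_quot omega f p.1 p.2 |
    p in [set p : {i01 R} * {i01 R} |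
      p.1 <> p.2 /\ `|p.1%:num - p.2%:num| <= t]].

Definition c_omega omega : set ({i01 R} -> R) :=
  [set f | C_omega omega f /\ omega_osc omega f t @[t --> 0^'+] --> 0%E].

End omega_spaces.

Section omega_norm_theory.
Context {R : realType} (omega : modulus R).
Implicit Types f g h : {i01 R} -> R.

Lemma dist01P (x y : {i01 R}) : x <> y -> 0 < `|x%:num - y%:num| <= 1.
Proof.
move=> xy; rewrite normr_gt0 subr_eq0; apply/andP; split.
  by apply/eqP => /val_inj.
have := (ge0 x, ge0 y, le1 x, le1 y); move: (x%:num) (y%:num) => a b.
by move=> [[[? ?] ?] ?]; rewrite ler_norml; apply/andP; split; lra.
Qed.

Lemma omega_dist_gt0 (x y : {i01 R}) :
  x <> y -> (0 < omega `|x%:num - y%:num|%R)%E.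
Proof. by move=> /dist01P; exact: (modulus_gt0 (modulusP omega)). Qed.

Lemma omega_quot_ge0 f (x y : {i01 R}) : x <> y ->
  (0 <= omega_quot omega f x y)%E.
Proof.
by move=> /omega_dist_gt0 w0; rewrite mule_ge0 ?inve_ge0 ?lee_fin// ltW.
Qed.

Lemma sup_norm_ge0 f : (0 <= sup_norm f)%E.
Proof.
apply: (@le_trans _ _ (`|f 0%:i01|)%:E); first by rewrite lee_fin.
by apply: ereal_sup_ubound; exists 0%:i01.
Qed.

Lemma omega_seminorm_ge0 f : (0 <= omega_seminorm omega f)%E.
Proof.
have n01 : 0%:i01 <> 1%:i01 :> {i01 R}.
  by move=> /(congr1 (fun x : {i01 R} => x%:num)) /= /eqP; rewrite eq_sym oner_eq0.
apply: (@le_trans _ _ (omega_quot omega f 0%:i01 1%:i01)).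
  exact: omega_quot_ge0.
by apply: ereal_sup_ubound; exists (0%:i01, 1%:i01).
Qed.

Lemma sup_normD f g h : (forall x, `|f x| <= `|g x| + `|h x|) ->
  (sup_norm f <= sup_norm g + sup_norm h)%E.
Proof.
move=> fgh; apply: ge_ereal_sup => _ [x _ <-].
apply: (@le_trans _ _ ((`|g x|)%:E + (`|h x|)%:E)%E).
  by rewrite -EFinD lee_fin.
by apply: leeD; apply: ereal_sup_ubound; exists x.
Qed.

Lemma omega_seminormD f g h :
  (forall x y, `|f x - f y| <= `|g x - g y| + `|h x - h y|) ->
  (omega_seminorm omega f <= omega_seminorm omega g + omega_seminorm omega h)%E.
Proof.
move=> fgh; apply: ge_ereal_sup => _ [[x y] /= xy <-].
apply: (@le_trans _ _ (omega_quot omega g x y + omega_quot omega h x y)%E).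
  rewrite /omega_quot -ge0_muleDl ?lee_fin// lee_wpmul2r ?lee_fin//.
  by rewrite inve_ge0 ltW// omega_dist_gt0.
by apply: leeD; apply: ereal_sup_ubound; exists (x, y).
Qed.

Lemma C_omega_bounded f : C_omega omega f -> (sup_norm f < +oo)%E.
Proof.
rewrite /C_omega /= => fC.
have sfin : omega_seminorm omega f \is a fin_num.
  by rewrite ge0_fin_numE// omega_seminorm_ge0.
pose K := fine (omega_seminorm omega f).
have KE : K%:E = omega_seminorm omega f by rewrite fineK.
have K0 : 0 <= K by rewrite -lee_fin KE omega_seminorm_ge0.
have [e /= e0 He] : exists2 e : R, 0 < e &
    forall t, 0 < t < e -> (omega t < 1)%E.
  have := modulus_cvg0 (modulusP omega).
  move=> /(_ [set x | (x < 1)%E]) /(_ (open_ereal_lt' (@lte01 R))).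
  move=> [e /= e0 He]; exists e => // t /andP[t0 te]; apply: He => //=.
  by rewrite sub0r normrN gtr0_norm.
pose d := e / 2.
have d0 : 0 < d by rewrite divr_gt0.
have step (x y : {i01 R}) : `|x%:num - y%:num| <= d -> `|f x - f y| <= K.
  have [-> _|/eqP xy xyd] := eqVneq x y; first by rewrite (subrr (f y)) normr0.
  have /andP[t0 t1] := dist01P xy.
  have w1 : (omega `|x%:num - y%:num|%R < 1)%E.
    by apply: He; rewrite t0 /=; move: xyd; rewrite /d; lra.
  have w0 := omega_dist_gt0 xy.
  have : (omega_quot omega f x y <= K%:E)%E.
    by rewrite KE; apply: ereal_sup_ubound; exists (x, y).
  rewrite /omega_quot; move: w0 w1; case: (omega _) => [w||]//=.
  rewrite !lte_fin => w0 w1; rewrite inver gt_eqF// -EFinM lee_fin.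
  rewrite ler_pdivrMr// => /le_trans; apply.
  by rewrite ler_piMr// ltW.
have chain n (x : {i01 R}) : x%:num <= n%:R * d ->
    `|f x - f 0%:i01| <= n%:R * K.
  elim: n x => [|n IH] x; rewrite ?mul0r.
    move=> x0; have -> : x = 0%:i01.
      by apply/val_inj/eqP; rewrite /= eq_le x0 ge0.
    by rewrite subrr normr0.
  rewrite -natr1 !mulrDl !mul1r => xn.
  have [xd|dx] := leP (x%:num) d.
    have : `|f x - f 0%:i01| <= K.
      by apply: step; rewrite /= subr0 ger0_norm.
    by move=> /le_trans; apply; rewrite lerDr mulr_ge0.
  have y0 : 0 <= x%:num - d by lra.
  have y1 : x%:num - d <= 1 by rewrite lerBlDr (le_trans (le1 x))// lerDl ltW.
  pose y : {i01 R} := Itv01 y0 y1.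
  have -> : f x - f 0%:i01 = (f y - f 0%:i01) + (f x - f y) by ring.
  apply: (le_trans (ler_normD _ _)); apply: lerD.
    by apply: IH; rewrite /=; lra.
  by apply: step; rewrite /= opprB addrC subrK gtr0_norm.
pose N := (Num.truncn d^-1).+1.
have Nd : 1 <= N%:R * d.
  by rewrite -ler_pdivrMr// mul1r ltW// truncnS_gt.
apply: (@le_lt_trans _ _ (`|f 0%:i01| + N%:R * K)%:E); last exact: ltry.
apply: ge_ereal_sup => _ [x _ <-]; rewrite lee_fin.
have -> : f x = f 0%:i01 + (f x - f 0%:i01) by ring.
apply: (le_trans (ler_normD _ _)); rewrite lerD2l; apply: chain.
by apply: le_trans Nd; exact: le1.
Qed.

Lemma omega_norm_ge0 f : (0 <= omega_norm omega f)%E.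
Proof. by rewrite adde_ge0 ?sup_norm_ge0 ?omega_seminorm_ge0. Qed.

Lemma omega_norm_fin f : C_omega omega f -> omega_norm omega f \is a fin_num.
Proof.
move=> fC; rewrite ge0_fin_numE ?omega_norm_ge0// /omega_norm.
by rewrite lte_add_pinfty// C_omega_bounded.
Qed.

Lemma C_omegaB f g : C_omega omega f -> C_omega omega g ->
  C_omega omega (f \- g).
Proof.
move=> fC gC; apply: (@le_lt_trans _ _
  (omega_seminorm omega f + omega_seminorm omega g)%E); last first.
  exact: lte_add_pinfty.
apply: omega_seminormD => x y /=.
have -> : f x - g x - (f y - g y) = (f x - f y) - (g x - g y) by ring.
exact: ler_normB.
Qed.

End omega_norm_theory.

Record little_space (R : realType) (omega : modulus R) := LittleSpace {
  little_fun :> {i01 R} -> R ;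
  little_funP : c_omega omega little_fun }.

HB.instance Definition _ (R : realType) (omega : modulus R) :=
  gen_eqMixin (little_space omega).
HB.instance Definition _ (R : realType) (omega : modulus R) :=
  gen_choiceMixin (little_space omega).

Section little_space_metric.
Context {R : realType} (omega : modulus R).
Implicit Types f g h : little_space omega.

Definition omega_dist f g : R := fine (omega_norm omega (f \- g)).

Lemma omega_distE f g : (omega_dist f g)%:E = omega_norm omega (f \- g).
Proof.
rewrite fineK//; apply: omega_norm_fin; apply: C_omegaB.
- by case: (little_funP f).
- by case: (little_funP g).
Qed.

Lemma omega_distxx f : omega_dist f f = 0.
Proof.
apply/EFin_inj; rewrite omega_distE; apply/eqP.
rewrite eq_le omega_norm_ge0 andbT -[leRHS]adde0; apply: leeD.
  by apply: ge_ereal_sup => _ [x _ <-]; rewrite /= subrr normr0.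
apply: ge_ereal_sup => _ [[x y] _ <-].
by rewrite /omega_quot /= !subrr normr0 mul0e.
Qed.

Lemma omega_dist_positivity f g : omega_dist f g = 0 -> f = g.
Proof.
move=> fg0; have {fg0} : omega_norm omega (f \- g) = 0%E.
  by rewrite -omega_distE fg0.
move=> /eqP; rewrite padde_eq0 ?sup_norm_ge0 ?omega_seminorm_ge0//.
move=> /andP[/eqP s0 _].
have fg : little_fun f = little_fun g.
  apply/funext => x; apply/eqP; rewrite -subr_eq0 -normr_le0 -lee_fin.
  apply: (@le_trans _ _ (sup_norm (f \- g))); last by rewrite s0.
  by apply: ereal_sup_ubound; exists x.
case: f g fg {s0} => f fP [g gP] /= fg; subst g; congr LittleSpace.
exact: Prop_irrelevance.
Qed.

Lemma omega_dist_triangle g f h :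
  omega_dist f h <= omega_dist f g + omega_dist g h.
Proof.
rewrite -lee_fin EFinD !omega_distE /omega_norm addeACA; apply: leeD.
  by apply: sup_normD => x /=; rewrite -(subrKA (g x)) ler_normD.
apply: omega_seminormD => x y /=.
have -> : f x - h x - (f y - h y) =
  (f x - g x - (f y - g y)) + (g x - h x - (g y - h y)) by ring.
exact: ler_normD.
Qed.

Lemma omega_dist_sym f g : omega_dist f g = omega_dist g f.
Proof.
rewrite /omega_dist /omega_norm; congr (fine (_ + _)%E); rewrite /sup_norm.
  by congr (ereal_sup _); apply: eq_imagel => x _ /=; rewrite distrC.
congr (ereal_sup _); apply: eq_imagel => -[x y] _; rewrite /omega_quot /=.
congr (_%:E / _)%E; rewrite -normrN; congr (`|_|); ring.
Qed.

HB.instance Definition _ := isMetric.Build R (little_space omega)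
  omega_distxx omega_dist_positivity omega_dist_sym omega_dist_triangle.

End little_space_metric.

Lemma powR_is_modulus (R : realType) (a : R) : 0 < a ->
  is_modulus (fun t : R => (t `^ a)%:E).
Proof.
move=> a0; split.
- by rewrite powR0// gt_eqF.
- by move=> t /andP[t0 _]; rewrite lte_fin powR_gt0.
- move=> s t s0 st _; rewrite lee_fin ge0_ler_powR ?nnegrE ?(ltW a0)//.
  exact: le_trans st.
- by apply: cvg_EFin; [exact: nearW | exact: powR_cvg0].
Qed.

Definition holder_modulus (R : realType) (a : R) (a0 : 0 < a) : modulus R :=
  Modulus (powR_is_modulus a0).

(* Main.v *)
(* Write [w] for the modulus and [m = max eta theta]; in all cases with
   [eta < 1] the value is [1 + (1 - m) / (1 - theta)].

   Upper bounds: a ball of radius [r^theta] meets the graph in at most about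
   [r^theta / r] columns of width [r], and in each of them the function
   oscillates by at most [C * min (w r) (r^theta)]; an [r]-packing has at most
   one point in each [r]-cell.

   Lower bound for typical functions: Lipschitz functions are dense in the
   little space (infimal convolution with [L * |s|]), and adding to one of them
   the wave [delta * w r * tent (x / r)], whose [w]-seminorm is at most [delta]
   by concavity, makes every column of the wave of height about [delta * w r].
   For [r] small this beats the Lipschitz constant, and the count survives
   sup-norm perturbations of size [r / 2].  Hence the functions having such a
   column structure at some scale below [1 / n] contain a dense open set, and
   those having it for all [n] form a residual set. *)
Require Import Defs.
From HB Require Import structures.
From mathcomp Require Import all_boot all_order all_algebra.
From mathcomp Require Import interval_inference ring lra.
From mathcomp Require Import all_classical all_reals all_analysis.

Set Implicit Arguments.
Unset Strict Implicit.
Unset Printing Implicit Defensive.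

Import Order.TTheory GRing.Theory Num.Theory.
Import numFieldNormedType.Exports.

Local Open Scope classical_set_scope.
Local Open Scope ring_scope.

(** * Packings in the plane *)

Section packing.
Context {R : realType}.
Implicit Types (r : R) (E : set 'rV[R]_2) (p q : 'rV[R]_2).

Lemma ord2P (i : 'I_2) : i = 0 \/ i = 1.
Proof. by case: i => -[|[|//]] ?; [left|right]; exact/val_inj. Qed.

Lemma edist2E p q :
  Defs.edist p q = Num.sqrt ((p 0 0 - q 0 0) ^+ 2 + (p 0 1 - q 0 1) ^+ 2).
Proof.
rewrite /Defs.edist !big_ord_recl big_ord0 addr0; congr (Num.sqrt (_ + _)).
by have -> : lift ord0 ord0 = 1 :> 'I_2 by exact/val_inj.
Qed.

Lemma edist2_lt r p q : 0 < r -> `|p 0 0 - q 0 0| <= r / 2 ->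
  `|p 0 1 - q 0 1| <= r / 2 -> Defs.edist p q < r.
Proof.
move=> r0 h0 h1; rewrite edist2E -[ltRHS]gtr0_norm// -sqrtr_sqr ltr_sqrt.
  rewrite -(real_normK (num_real (_ - _))) -(real_normK (num_real (p 0 1 - _))).
  move: h0 h1 (normr_ge0 (p 0 0 - q 0 0)) (normr_ge0 (p 0 1 - q 0 1)).
  by move: `|_| `|_| => a b ha hb a0 b0; nra.
by rewrite exprn_gt0.
Qed.

Lemma edist2_coord p q (i : 'I_2) : `|p 0 i - q 0 i| <= Defs.edist p q.
Proof.
rewrite edist2E -sqrtr_sqr ler_sqrt ?addr_ge0 ?sqr_ge0//.
by have [->|->] := ord2P i; rewrite ?lerDl ?lerDr sqr_ge0.
Qed.

(** A common point of two closed [r]-balls would bring their centres within [2 * r] in every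
    coordinate. An arbitrary finite index type lets the centres be indexed by pairs (column,
    height). *)
Lemma packing_number_ge (T : finType) (c : T -> 'rV[R]_2) r E :
  (forall t, E (c t)) ->
  (forall s t, s != t -> exists i, 2 * r < `|c s 0 i - c t 0 i|) ->
  ((#|T|%:R)%:E <= packing_number r E)%E.
Proof.
move=> Ec sep; apply: ereal_sup_ubound; exists #|T| => //.
exists (c \o enum_val); split=> [i|i j _ _ [z [/= zi zj]]]; first exact: Ec.
apply/enum_val_inj/eqP/negP => /negP /sep[k].
rewrite ltNge => /negP; apply.
have := edist2_coord (c (enum_val i)) z k; have := edist2_coord (c (enum_val j)) z k.
move: zi zj; rewrite /closed_eball /= => zi zj hj hi.
rewrite -(subrKA (z 0 k)) (le_trans (ler_normD _ _))// mulr_natl mulr2n lerD//.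
  exact: le_trans hi _.
by rewrite distrC; exact: le_trans hj _.
Qed.

(* Two points in a common [r]-cell are too close for their closed [r]-balls to
   be disjoint, since both balls contain the midpoint. *)
Lemma packing_number_le (T : finType) (g : 'rV[R]_2 -> T) r E : 0 < r ->
  (forall p q, E p -> E q -> g p = g q -> forall i, `|p 0 i - q 0 i| <= r) ->
  (packing_number r E <= (#|T|%:R)%:E)%E.
Proof.
move=> r0 hg; apply: ge_ereal_sup => _ [n /= [c [Ec dc]] <-].
rewrite lee_fin ler_nat -[leqLHS]card_ord; apply: (@leq_card _ _ (g \o c)).
move=> i j /= /(hg _ _ (Ec i) (Ec j)) cij; apply: dc => //.
pose m := 2^-1 *: (c i + c j).
have m0 k : `|c i 0 k - m 0 k| <= r / 2 /\ `|c j 0 k - m 0 k| <= r / 2.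
  rewrite !mxE; have := cij k; rewrite !ler_norml => /andP[? ?].
  by split; apply/andP; split; lra.
exists m; split; rewrite /closed_eball/=; apply/ltW/edist2_lt=> //.
- by have [] := m0 0.
- by have [] := m0 1.
- by have [] := m0 0.
- by have [] := m0 1.
Qed.

End packing.

(** * Bounds on the Assouad spectrum of a graph *)

Section graph_packing.
Context {R : realType}.
Implicit Types (r theta s K : R) (f : {i01 R} -> R).

Definition graph_point f (x : {i01 R}) : 'rV[R]_2 :=
  \row_(i < 2) [:: x%:num; f x]`_i.

Lemma graph_point0 f x : graph_point f x 0 0 = x%:num.
Proof. by rewrite mxE. Qed.

Lemma graph_point1 f x : graph_point f x 0 1 = f x.
Proof. by rewrite mxE. Qed.

Lemma graph_graph_point f x : graph f (graph_point f x).
Proof. by exists x. Qed.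

Definition clamp01_num (x : R) : R := Num.max 0 (Num.min x 1).

Lemma clamp01_num_ge0 x : 0 <= clamp01_num x.
Proof. by rewrite le_max lexx. Qed.

Lemma clamp01_num_le1 x : clamp01_num x <= 1.
Proof. by rewrite ge_max ler01 ge_min lexx orbT. Qed.

(** Retraction of the line onto the unit interval. Composing with it extends [f] to the whole line
    by constants, so that continuity, the intermediate value theorem and translations apply to real
    arguments. *)
Definition clamp01 (x : R) : {i01 R} :=
  Itv01 (clamp01_num_ge0 x) (clamp01_num_le1 x).

Lemma clamp01K (x : {i01 R}) : clamp01 x%:num = x.
Proof.
by apply/val_inj; rewrite /= /clamp01_num (min_idPl (le1 x)) (max_idPr (ge0 x)).
Qed.

Lemma clamp01_id (x : R) : 0 <= x <= 1 -> (clamp01 x)%:num = x.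
Proof.
by move=> /andP[x0 x1]; rewrite /= /clamp01_num (min_idPl x1) (max_idPr x0).
Qed.

Lemma dist_clamp01 (x y : R) :
  `|(clamp01 x)%:num - (clamp01 y)%:num| <= `|x - y|.
Proof.
wlog xy : x y / x <= y.
  move=> h; have [/h//|/ltW/h] := leP x y.
  by rewrite distrC [leRHS]distrC.
rewrite /= /clamp01_num [leRHS]distrC [leRHS]ger0_norm ?subr_ge0//.
case: (leP x 1) => x1; case: (leP y 1) => y1; rewrite ?(max_idPr ler01).
- by case: (leP 0 x) => ?; case: (leP 0 y) => ?; rewrite ler_norml; lra.
- by case: (leP 0 x) => ?; rewrite ler_norml; lra.
- by case: (leP 0 y) => ?; rewrite ler_norml; lra.
- by rewrite ler_norml; lra.
Qed.

Lemma dist01_le1 (x y : {i01 R}) : `|x%:num - y%:num| <= 1.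
Proof.
have := (ge0 x, ge0 y, le1 x, le1 y); move: (x%:num) (y%:num) => a b.
by move=> [[[? ?] ?] ?]; rewrite ler_norml; apply/andP; split; lra.
Qed.

Lemma truncn_mul_itv r u : 0 < r -> 0 <= u ->
  (Num.truncn (u / r))%:R * r <= u < (Num.truncn (u / r))%:R * r + r.
Proof.
move=> r0 u0; have := truncn_itv (divr_ge0 u0 (ltW r0)).
by rewrite ler_pdivlMr// ltr_pdivrMr// -natr1 mulrDl mul1r.
Qed.

(** Cut [E] into columns of width [r] from [a - rho] on, and column [k] into rows of height [r] from
    [ref k - H] on; each cell holds at most one centre. Letting the reference height vary with the
    column follows a graph that drifts. *)
Lemma packing_columns_le (E : set 'rV[R]_2) (a rho H r : R) (ref : nat -> R) :
  0 < r -> 0 <= rho -> 0 <= H ->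
  (forall p, E p -> `|p 0 0 - a| <= rho) ->
  (forall p, E p ->
    `|p 0 1 - ref (Num.truncn ((p 0 0 - a + rho) / r))| <= H) ->
  (packing_number r E <= ((2 * rho / r + 1) * (2 * H / r + 1))%:E)%E.
Proof.
move=> r0 rho0 H0 Ea Eref.
pose col (p : 'rV[R]_2) := Num.truncn ((p 0 0 - a + rho) / r).
pose row (p : 'rV[R]_2) := Num.truncn ((p 0 1 - ref (col p) + H) / r).
pose A := Num.truncn (2 * rho / r); pose B := Num.truncn (2 * H / r).
have colA p : E p -> (col p < A.+1)%N.
  move=> /Ea; rewrite ler_norml => /andP[? ?]; apply/le_truncn.
  by rewrite ler_pM2r ?invr_gt0//; lra.
have rowB p : E p -> (row p < B.+1)%N.
  move=> /Eref; rewrite ler_norml => /andP[? ?]; apply/le_truncn.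
  by rewrite ler_pM2r ?invr_gt0// /col; lra.
have cell (u v : R) : 0 <= u -> 0 <= v ->
    Num.truncn (u / r) = Num.truncn (v / r) -> `|u - v| <= r.
  move=> u0 v0 uv.
  have := truncn_mul_itv r0 u0; have := truncn_mul_itv r0 v0.
  rewrite uv; move: (_%:R * r) => c /andP[? ?] /andP[? ?].
  by rewrite ler_norml; apply/andP; split; lra.
apply: (@le_trans _ _ ((#|{: 'I_A.+1 * 'I_B.+1}|%:R)%:E)).
  (* [colA] and [rowB] make [inord] faithful on [E]; its default value only occurs outside [E]. *)
  apply: (@packing_number_le _ _ (fun p => (inord (col p), inord (row p)))) => //.
  move=> p q Ep Eq [] /(congr1 val); rewrite /= !inordK ?colA// => cpq.
  move=> /(congr1 val); rewrite /= !inordK ?rowB// => rpq i.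
  move: (Ea _ Ep) (Ea _ Eq) (Eref _ Ep) (Eref _ Eq).
  rewrite -/(col p) -/(col q) => /ler_normlP[? ?] /ler_normlP[? ?].
  move=> /ler_normlP[? ?] /ler_normlP[? ?]; have [->|->] := ord2P i.
  - have -> : p 0 0 - q 0 0 = p 0 0 - a + rho - (q 0 0 - a + rho) by ring.
    by apply: cell => //; lra.
  - have -> : p 0 1 - q 0 1 =
      p 0 1 - ref (col p) + H - (q 0 1 - ref (col p) + H) by ring.
    apply: cell; [lra|rewrite cpq; lra|].
    by move: rpq; rewrite /row -cpq.
rewrite card_prod !card_ord lee_fin natrM.
have le_trunc1 x : 0 <= x -> (Num.truncn x).+1%:R <= x + 1.
  by move=> x0; rewrite -natr1 lerD2r truncn_le.
by apply: ler_pM; rewrite ?ler0n//; apply: le_trunc1;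
  rewrite divr_ge0 ?mulr_ge0// ltW.
Qed.

Lemma open_eball_graph f (x : {i01 R}) rho p :
  (open_eball (graph_point f x) rho `&` graph f) p ->
  exists y, [/\ p = graph_point f y, `|y%:num - x%:num| <= rho &
                `|f y - f x| <= rho].
Proof.
move=> [/ltW pb [y _ yp]]; exists y; split; first by rewrite -yp.
- have := le_trans (edist2_coord (graph_point f x) p 0) pb.
  by rewrite -yp -/(graph_point f y) !graph_point0 distrC.
- have := le_trans (edist2_coord (graph_point f x) p 1) pb.
  by rewrite -yp -/(graph_point f y) !graph_point1 distrC.
Qed.

Lemma powRD_gt0 (x a b : R) : 0 < x -> x `^ (a + b) = x `^ a * x `^ b.
Proof. by move=> x0; rewrite powRD// (gt_eqF x0) implybT. Qed.

Lemma powRB_gt0 (x a b : R) : 0 < x -> x `^ (a - b) = x `^ a / x `^ b.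
Proof. by move=> x0; rewrite powRB// (gt_eqF x0) implybT. Qed.

(** As [r ^ theta / r = r ^ (theta - 1)], this translates powers of the ratio of scales, in which
    the spectrum is defined, into powers of [r]. *)
Lemma ratio_powR r theta b : 0 < r -> theta != 1 ->
  (r `^ theta / r) `^ (b / (1 - theta)) = r `^ (- b).
Proof.
move=> r0 t1; rewrite -{2}[r]powRr1 ?ltW// -powRB_gt0//.
rewrite -powRrM; congr (_ `^ _); field; rewrite subr_eq0 eq_sym.
exact: t1.
Qed.

Lemma assouad_spectrum_le2 f theta : 0 < theta < 1 ->
  (assouad_spectrum theta (graph f) <= 2%:E)%E.
Proof.
move=> /andP[t0 t1]; apply: ereal_inf_lbound; exists 2 => //; exists 9; split=> //.
move=> r /andP[r0 r1] _ [x _ <-]; rewrite -/(graph_point f x).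
set rho := r `^ theta.
have rrho : r <= rho by apply: ger1_powR; rewrite ?r0 ltW.
have rho0 : 0 <= rho by exact: powR_ge0.
apply: (le_trans (@packing_columns_le _ x%:num rho rho r (fun=> f x) r0 rho0 rho0
  _ _)).
- by move=> p /open_eball_graph[y [-> h _]]; rewrite graph_point0.
- by move=> p /open_eball_graph[y [-> _ h]]; rewrite graph_point1.
rewrite lee_fin powR_mulrn ?divr_ge0 ?(ltW r0)//.
have : 1 <= rho / r by rewrite ler_pdivlMr// mul1r.
rewrite -!mulrA; move: (rho / r) => c c1.
(* This product is [9 * c ^ 2 - (2 * c + 1) ^ 2], which explains the constant 9. *)
have : 0 <= (c - 1) * (5 * c + 1) by apply: mulr_ge0; lra.
by nra.
Qed.

(** In each column [f] stays within [K * r ^ s] of its value at the left end. With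
    [c = r ^ theta / r] and [d = r ^ s / r], both at least 1, the count is at most
    [3 * c * ((2 * K + 1) * d)], and [d] is the power [(1 - s) / (1 - theta)] of [c]. *)
Lemma assouad_spectrum_holder_le f theta s K : 0 < theta < 1 -> 0 <= s <= 1 ->
  0 <= K ->
  (forall x y, `|f x - f y| <= K * `|x%:num - y%:num| `^ s) ->
  (assouad_spectrum theta (graph f) <= (1 + (1 - s) / (1 - theta))%:E)%E.
Proof.
move=> /andP[t0 t1] /andP[s0 s1] K0 fK; apply: ereal_inf_lbound.
exists (1 + (1 - s) / (1 - theta)) => //; exists (3 * (2 * K + 1)); split.
  by rewrite mulr_gt0// ltr_wpDl// mulr_ge0.
move=> r /andP[r0 r1] _ [x _ <-]; rewrite -/(graph_point f x).
set rho := r `^ theta.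
have rrho : r <= rho by apply: ger1_powR; rewrite ?r0 ltW.
have rho0 : 0 <= rho by exact: powR_ge0.
have H0 : 0 <= K * r `^ s by rewrite mulr_ge0// powR_ge0.
(* The value at the left end of column [k], clamped since that end may be negative. *)
pose ref (k : nat) := f (clamp01 (x%:num - rho + k%:R * r)).
apply: (le_trans (@packing_columns_le _ x%:num rho _ r ref r0 rho0 H0 _ _)).
- by move=> p /open_eball_graph[y [-> h _]]; rewrite graph_point0.
- move=> p /open_eball_graph[y [-> h _]]; rewrite graph_point1 graph_point0.
  apply: (le_trans (fK _ _)); rewrite ler_wpM2l//.
  apply: ge0_ler_powR; rewrite ?nnegrE ?(ltW r0)//.
  rewrite -{1}(clamp01K y); apply: (le_trans (dist_clamp01 _ _)).
  have y0 : 0 <= y%:num - x%:num + rho by move: h; rewrite ler_norml; lra.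
  have := truncn_mul_itv r0 y0; move: (_%:R * r) => c /andP[? ?].
  by rewrite ler_norml; apply/andP; split; lra.
have rr1 : 0 < rho / r by rewrite divr_gt0 ?powR_gt0.
rewrite lee_fin powRD_gt0// powRr1 ?(ltW rr1)//.
rewrite ratio_powR ?lt_eqF// opprB powRB_gt0// powRr1 ?(ltW r0)//.
have c1 : 1 <= rho / r by rewrite ler_pdivlMr// mul1r.
have d1 : 1 <= r `^ s / r.
  by rewrite ler_pdivlMr// mul1r; apply: ger1_powR; rewrite ?r0 ?(ltW r1).
have -> : 2 * rho / r = 2 * (rho / r) by rewrite !mulrA.
have -> : 2 * (K * r `^ s) / r = 2 * K * (r `^ s / r) by rewrite !mulrA.
move: c1 d1; move: (rho / r) (r `^ s / r) => c d c1 d1.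
apply: (@le_trans _ _ ((3 * c) * ((2 * K + 1) * d))).
  apply: ler_pM; [lra| |lra|nra].
  by rewrite addr_ge0 ?mulr_ge0//; lra.
by rewrite le_eqVlt; apply/orP; left; apply/eqP; ring.
Qed.

(** A single [e] bounds both the scale and the loss in the exponent. An admissible [c < b] would
    leave a surplus [(r ^ theta / r) ^ (b - c)], a negative power of [r], which beats the loss
    [r ^ e] and the constant [C]. *)
Lemma assouad_spectrum_ge theta b (F : set 'rV[R]_2) : 0 < theta < 1 ->
  (forall e, 0 < e -> exists r p, [/\ 0 < r < e, F p &
    ((r `^ e * (r `^ theta / r) `^ b)%:E <=
       packing_number r (open_eball p (r `^ theta) `&` F))%E]) ->
  (b%:E <= assouad_spectrum theta F)%E.
Proof.
move=> /andP[t0 t1] H; apply: le_ereal_inf_tmp => _ [c [C [C0 cC]] <-].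
rewrite lee_fin leNgt; apply/negP => cb.
(* The surplus is [r ^ (- 2 * k)]: one factor [r ^ (- k)] pays for [r ^ e], the other exceeds [C]
   once [r < C ^ (- 1 / k)]. *)
pose k := (1 - theta) * (b - c) / 2.
have k0 : 0 < k by rewrite divr_gt0// mulr_gt0// subr_gt0.
pose e := Num.min (Num.min k 1) (C `^ (- k^-1)).
have e0 : 0 < e by rewrite !lt_min k0 ltr01 powR_gt0.
have [r [p [/andP[r0]]]] := H e e0.
rewrite !lt_min => /andP[/andP[rk r1] rC] Fp.
have r01 : 0 < r < 1 by rewrite r0.
move=> /le_trans/(_ (cC r r01 p Fp)); rewrite lee_fin; apply/negP.
have q0 : 0 < r `^ theta / r by rewrite divr_gt0 ?powR_gt0.
rewrite -ltNge -{1}(subrK c b) powRD_gt0// mulrA ltr_pM2r ?powR_gt0//.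
have -> : b - c = (k + k) / (1 - theta).
  by rewrite /k; field; rewrite gt_eqF// subr_gt0.
rewrite ratio_powR ?lt_eqF// -powRD_gt0//.
apply: (@lt_le_trans _ _ (r `^ (- k))).
  rewrite powRN -[ltLHS]invrK ltf_pV2 ?posrE ?powR_gt0 ?invr_gt0//.
  have -> : C^-1 = (C `^ (- k^-1)) `^ k.
    by rewrite -powRrM mulNr mulVf ?gt_eqF// powR_inv1// ltW.
  by apply: gt0_ltr_powR => //; rewrite nnegrE ?powR_ge0 ?(ltW r0).
apply: ger_powR; first by rewrite r0 ltW.
have : e <= k by rewrite /e !ge_min lexx.
by lra.
Qed.

(** Along the graph, the sup-norm distance [D] to the point above 0 varies continuously from 0 to at
    least 1. Points where it equals [3 * r * k] are separated at scale [r], and about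
    [r ^ theta / (6 * r)] of them fit into the ball. *)
Lemma assouad_spectrum_ge1 f theta : 0 < theta < 1 ->
  continuous (f \o clamp01) -> (1%:E <= assouad_spectrum theta (graph f))%E.
Proof.
move=> /andP[t0 t1] fc; apply: assouad_spectrum_ge; first by rewrite t0.
(* The last bound gives [r ^ e <= 1 / 6], which absorbs the constant in the count. *)
move=> e e0; pose m := Num.min (Num.min e 1) (6^-1 `^ e^-1).
have m0 : 0 < m by rewrite !lt_min e0 ltr01 powR_gt0// invr_gt0.
have [r r0] : exists2 r, 0 < r & r < m by exists (m / 2); lra.
rewrite !lt_min => /andP[/andP[re r1] r6].
exists r, (graph_point f (clamp01 0)); split; first by rewrite r0.
  exact: graph_graph_point.
pose F := f \o clamp01; pose D y := Num.max `|y| `|F y - F 0|.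
set rho := r `^ theta.
have rho0 : 0 < rho by exact: powR_gt0.
have rho1 : rho <= 1 by rewrite -(powRr0 r); apply: ger_powR; rewrite ?r0 ltW.
pose N := Num.truncn (rho / (6 * r)).
have /choice[y yD] : forall k : 'I_N.+1, exists y,
    0 <= y <= 1 /\ D y = 3 * r * k%:R.
  move=> k.
  have [||y] := @IVT _ D 0 1 (3 * r * k%:R) ler01.
  - apply: continuous_subspaceT => z; apply: continuous_max.
      exact: norm_continuous.
    apply: continuous_comp; last exact: norm_continuous.
    by apply: continuousB; [exact: fc|exact: cst_continuous].
  - rewrite ge_min le_max; apply/andP; split; apply/orP; [left|right].
      by rewrite /D subrr !normr0 maxxx mulr_ge0 ?mulr_ge0// ltW.
    rewrite /D le_max normr1; apply/orP; left.
    have : (k%:R : R) <= rho / (6 * r).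
      rewrite -truncn_ge_nat; first by rewrite -ltnS.
      by rewrite divr_ge0 ?mulr_ge0 ?ltW.
    rewrite ler_pdivlMr ?mulr_gt0//; move: (k%:R) => kk; nra.
  - by rewrite in_itv/= => y01 Dy; exists y.
have kr (k : 'I_N.+1) : 3 * r * k%:R <= rho / 2.
  have : (k%:R : R) <= rho / (6 * r).
    rewrite -truncn_ge_nat; first by rewrite -ltnS.
    by rewrite divr_ge0 ?mulr_ge0 ?ltW.
  by rewrite ler_pdivlMr ?mulr_gt0//; move: (k%:R) => kk; lra.
apply: le_trans (@packing_number_ge _ _ (fun k => graph_point f (clamp01 (y k)))
  r _ _ _).
- rewrite card_ord lee_fin powRr1 ?divr_ge0 ?(ltW r0) ?(ltW rho0)//.
  apply: (@le_trans _ _ (rho / (6 * r))); last exact/ltW/truncnS_gt.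
  rewrite invfM [leRHS]mulrCA ler_wpM2r ?divr_ge0 ?(ltW r0) ?(ltW rho0)//.
  have -> : 6^-1 = (6^-1 `^ e^-1) `^ e :> R.
    by rewrite -powRrM mulVf ?gt_eqF// powRr1// invr_ge0.
  by apply: ge0_ler_powR; rewrite ?nnegrE ?powR_ge0 ?(ltW e0) ?(ltW r0) ?(ltW r6).
- move=> k; split; last exact: graph_graph_point.
  have [y01 Dy] := yD k.
  apply: edist2_lt => //.
    rewrite !graph_point0 !clamp01_id ?lexx ?ler01// distrC subr0.
    by apply: le_trans (kr k); rewrite -Dy le_max lexx.
  rewrite !graph_point1 distrC.
  by apply: le_trans (kr k); rewrite -Dy le_max lexx orbT.
- move=> k l kl; have [yk Dk] := yD k; have [yl Dl] := yD l.
  (* Which coordinate separates the points is not known. If both differed by at most [2 * r], so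
     would the values of [D], which are distinct multiples of [3 * r]. *)
  apply/existsP; rewrite -[X in is_true X]negbK; apply/negP => /existsPn h.
  have h0 := h 0; have h1 := h 1; move: h0 h1.
  rewrite !graph_point0 !graph_point1 !clamp01_id// -!leNgt => h0 h1.
  have step (u v : R) : `|u - v| <= 2 * r -> `|F u - F v| <= 2 * r ->
      D u <= D v + 2 * r.
    move=> uv Fuv; rewrite /D ge_max; apply/andP; split.
      rewrite -[u in leLHS](subrK v) addrC (le_trans (ler_normD _ _))// lerD//.
      by rewrite le_max lexx.
    rewrite -(subrKA (F v)) addrC (le_trans (ler_normD _ _))// lerD//.
    by rewrite le_max lexx orbT.
  have := step _ _ h0 h1; rewrite [in X in X -> _]Dk [in X in X -> _]Dl.
  rewrite distrC in h0; rewrite distrC in h1.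
  have := step _ _ h0 h1; rewrite Dk Dl.
  move: kl; rewrite -val_eqE /= neq_ltn => /orP[]; rewrite -(ler_nat R) -natr1.
    by move: (_%:R) (_%:R) => a b; nra.
  by move: (_%:R) (_%:R) => a b; nra.
Qed.

End graph_packing.

(** * Concave moduli of continuity *)

Section modulus_theory.
Context {R : realType} (omega : modulus R) (conc : concave_on01 omega).
Implicit Types (f : {i01 R} -> R) (s t e K M : R).

Local Notation w t := (fine (omega t)).

(** If [omega t] were infinite, concavity between 0 and [t] would make [omega] infinite on all of
    [(0, t]], against its limit 0. *)
Lemma modulus_fineK t : 0 <= t <= 1 -> omega t = (w t)%:E.
Proof.
move=> /andP[]; rewrite le_eqVlt => /predU1P[<- _|t0 t1].
  by rewrite (modulus0 (modulusP omega)).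
have t01 : 0 < t <= 1 by rewrite t0.
have := modulus_gt0 (modulusP omega) t01.
case E : (omega t) => [//| |//] _; exfalso.
have [d /= d0 Hd] : exists2 d : R, 0 < d &
    forall u, 0 < u < d -> (omega u < 1)%E.
  have := modulus_cvg0 (modulusP omega).
  move=> /(_ [set x | (x < 1)%E]) /(_ (open_ereal_lt' (@lte01 R))).
  move=> [d /= d0 Hd]; exists d => // u /andP[u0 ud]; apply: Hd => //=.
  by rewrite sub0r normrN gtr0_norm.
pose u := Num.min (d / 2) t.
have u0 : 0 < u by rewrite lt_min t0 divr_gt0.
have ut : u <= t by rewrite ge_min lexx orbT.
have ud : u < d by rewrite gt_min; apply/orP; left; lra.
have k01 : 0 <= u / t <= 1.
  by rewrite divr_ge0 ?(ltW u0) ?(ltW t0)//= ler_pdivrMr// mul1r.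
have := @conc t 0 (u / t) _ _ k01.
rewrite lexx ler01 (ltW t0) t1 => /(_ isT isT).
have -> : u / t * t + (1 - u / t) * 0 = u by rewrite mulr0 addr0 divfK// gt_eqF.
rewrite E (modulus0 (modulusP omega)) mule0 adde0.
have k0 : (0 < (u / t)%:E)%E by rewrite lte_fin divr_gt0.
rewrite (gt0_muley k0) => oo.
have ud' : 0 < u < d by rewrite u0.
by have := le_lt_trans oo (Hd u ud'); rewrite ltNge leey.
Qed.

Lemma modulus_fine0 : w 0 = 0.
Proof. by rewrite (modulus0 (modulusP omega)). Qed.

Lemma modulus_fine_gt0 t : 0 < t <= 1 -> 0 < w t.
Proof.
move=> /andP[t0 t1]; rewrite -lte_fin -modulus_fineK ?(ltW t0)//.
by rewrite (modulus_gt0 (modulusP omega))// t0.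
Qed.

Lemma modulus_fine_ge0 t : 0 <= t <= 1 -> 0 <= w t.
Proof.
move=> /andP[]; rewrite le_eqVlt => /predU1P[<- _|t0 t1].
  by rewrite modulus_fine0.
by rewrite ltW// modulus_fine_gt0// t0.
Qed.

Lemma modulus_fine_nd s t : 0 <= s -> s <= t -> t <= 1 -> w s <= w t.
Proof.
move=> s0 st t1; rewrite -lee_fin -!modulus_fineK.
- exact: (modulus_nd (modulusP omega)).
- by rewrite t1 (le_trans s0).
- by rewrite s0 (le_trans st).
Qed.

(** Concavity along the chord from the origin: [w t / t] is non-increasing. *)
Lemma modulus_fine_ratio s t : 0 <= s -> s <= t -> t <= 1 -> 0 < t ->
  s / t * w t <= w s.
Proof.
move=> s0 st t1 t0.
have k01 : 0 <= s / t <= 1.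
  by rewrite divr_ge0 ?(ltW t0)//= ler_pdivrMr// mul1r.
have := @conc t 0 (s / t) _ _ k01.
rewrite lexx ler01 (ltW t0) t1 => /(_ isT isT).
have -> : s / t * t + (1 - s / t) * 0 = s by rewrite mulr0 addr0 divfK// gt_eqF.
rewrite (modulus0 (modulusP omega)) mule0 adde0.
by rewrite -lee_fin (EFinM (s / t)) -!modulus_fineK ?s0 ?(ltW t0) ?t1 ?(le_trans st t1).
Qed.

Lemma modulus_fine_small e : 0 < e ->
  exists2 d, 0 < d & forall t, 0 <= t < d -> t <= 1 -> w t < e.
Proof.
move=> e0.
have [d /= d0 Hd] : exists2 d : R, 0 < d &
    forall u, 0 < u < d -> (omega u < e%:E)%E.
  have := modulus_cvg0 (modulusP omega).
  have oe : nbhs 0%E [set x | (x < e%:E)%E] by apply: open_ereal_lt'; rewrite lte_fin.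
  move=> /(_ _ oe) [d /= d0 Hd]; exists d => // u /andP[u0 ud]; apply: Hd => //=.
  by rewrite sub0r normrN gtr0_norm.
exists d => // t /andP[]; rewrite le_eqVlt => /predU1P[<- _ _|t0 td t1].
  by rewrite modulus_fine0.
by rewrite -lte_fin -modulus_fineK ?(ltW t0)// Hd// t0.
Qed.

Lemma omega_quot_le f (x y : {i01 R}) K : x <> y ->
  (omega_quot omega f x y <= K%:E)%E =
  (`|f x - f y| <= K * w `|x%:num - y%:num|).
Proof.
move=> xy; have /andP[t0 t1] := dist01P xy.
have w0 : 0 < w `|x%:num - y%:num| by rewrite modulus_fine_gt0// t0.
rewrite /omega_quot modulus_fineK ?(ltW t0)//=.
by rewrite inver gt_eqF// -EFinM lee_fin ler_pdivrMr.
Qed.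

Lemma omega_seminorm_le f K :
  (forall x y, `|f x - f y| <= K * w `|x%:num - y%:num|) ->
  (omega_seminorm omega f <= K%:E)%E.
Proof.
by move=> h; apply: ge_ereal_sup => _ [[x y] /= xy <-]; rewrite omega_quot_le.
Qed.

Lemma C_omega_bound f : C_omega omega f -> exists2 K, 0 <= K &
  forall x y, `|f x - f y| <= K * w `|x%:num - y%:num|.
Proof.
rewrite /C_omega /= => fC.
have sfin : omega_seminorm omega f \is a fin_num.
  by rewrite ge0_fin_numE// omega_seminorm_ge0.
exists (fine (omega_seminorm omega f)).
  by rewrite fine_ge0// omega_seminorm_ge0.
move=> x y; have [->|/eqP xy] := eqVneq x y.
  by rewrite !subrr !normr0 modulus_fine0 mulr0.
rewrite -omega_quot_le// fineK//.
by apply: ereal_sup_ubound; exists (x, y).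
Qed.

Lemma c_omega_osc f e : c_omega omega f -> 0 < e -> exists2 d, 0 < d &
  forall x y, `|x%:num - y%:num| <= d ->
    `|f x - f y| <= e * w `|x%:num - y%:num|.
Proof.
move=> [_ fc] e0.
have oe : nbhs 0%E [set x | (x < e%:E)%E] by apply: open_ereal_lt'; rewrite lte_fin.
have [d /= d0 Hd] := fc _ oe.
exists (d / 2) => [|x y xyd]; first by rewrite divr_gt0.
have [->|/eqP xy] := eqVneq x y.
  by rewrite !subrr !normr0 modulus_fine0 mulr0.
rewrite -omega_quot_le//.
have : (omega_osc omega f (d / 2) < e%:E)%E.
  by apply: Hd => /=; rewrite ?sub0r ?normrN ?gtr0_norm; lra.
move=> /ltW; apply: le_trans; apply: ereal_sup_ubound.
by exists (x, y).
Qed.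

(** Finiteness of the seminorm combines the hypothesis for [e = 1] at small distances with the bound
    [2 * M / w d'] at larger ones. *)
Lemma c_omegaI f M : (forall x, `|f x| <= M) ->
  (forall e, 0 < e -> exists2 d, 0 < d &
    forall x y, `|x%:num - y%:num| <= d ->
      `|f x - f y| <= e * w `|x%:num - y%:num|) ->
  c_omega omega f.
Proof.
move=> fM fe.
have M0 : 0 <= M by apply: le_trans (fM 0%:i01).
split.
  have [d d0 Hd] := fe 1 ltr01; pose d' := Num.min d 1.
  have d'01 : 0 < d' <= 1 by rewrite lt_min d0 ltr01 ge_min lexx orbT.
  have wd := modulus_fine_gt0 d'01.
  apply: (@le_lt_trans _ _ (1 + (M + M) / w d')%:E); last exact: ltry.
  apply: omega_seminorm_le => x y.
  have w0 : 0 <= w `|x%:num - y%:num|.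
    by rewrite modulus_fine_ge0// normr_ge0 dist01_le1.
  have [xyd|dxy] := leP `|x%:num - y%:num| d'.
    apply: (le_trans (Hd _ _ _)).
      by apply: le_trans xyd _; rewrite ge_min lexx.
    by rewrite ler_wpM2r// lerDl divr_ge0 ?addr_ge0// ltW.
  apply: (@le_trans _ _ (M + M)).
    by rewrite (le_trans (ler_normB _ _))// lerD.
  apply: (@le_trans _ _ ((M + M) / w d' * w `|x%:num - y%:num|)).
    rewrite mulrAC ler_pdivlMr// ler_wpM2l ?addr_ge0//.
    have /andP[d'0 _] := d'01.
    by apply: modulus_fine_nd; rewrite ?(ltW d'0) ?(ltW dxy) ?dist01_le1.
  by rewrite ler_wpM2r// lerDr.
have osc e : 0 < e -> exists2 d, 0 < d & forall t, 0 < t -> t <= d ->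
    (0 <= omega_osc omega f t <= e%:E)%E.
  move=> /fe[d d0 Hd]; exists d => // t t0 td; apply/andP; split; last first.
    apply: ge_ereal_sup => _ [[x y] /= [xy xyt] <-].
    by rewrite omega_quot_le//; apply: Hd; exact: le_trans td.
  (* The empty supremum is [-oo], so nonnegativity needs an admissible pair at distance at most
     [t]. *)
  have xy : clamp01 t <> clamp01 0.
    move=> /(congr1 (fun x : {i01 R} => x%:num)) /eqP.
    rewrite [X in _ == X]clamp01_id ?lexx ?ler01// /= gt_eqF//.
    by rewrite /clamp01_num lt_max lt_min t0 ltr01 orbT.
  apply: (le_trans (omega_quot_ge0 omega f xy)); apply: ereal_sup_ubound.
  exists (clamp01 t, clamp01 0) => //=; split=> //.
  by apply: le_trans (dist_clamp01 _ _) _; rewrite subr0 gtr0_norm.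
apply/fine_cvgP; split.
  have [d d0 Hd] := osc 1 ltr01.
  near=> t.
  have t0 : 0 < t by near: t; exact: nbhs_right_gt.
  have td : t <= d by near: t; exact: nbhs_right_le.
  have /andP[q0 q1] := Hd t t0 td.
  by rewrite ge0_fin_numE// (le_lt_trans q1)// ltry.
apply/cvgrPdist_le => e e0.
have [d d0 Hd] := osc e e0.
near=> t.
have t0 : 0 < t by near: t; exact: nbhs_right_gt.
have td : t <= d by near: t; exact: nbhs_right_le.
have /andP[q0 q1] := Hd t t0 td.
rewrite sub0r normrN /= ger0_norm ?fine_ge0// -lee_fin fineK//.
by rewrite ge0_fin_numE// (le_lt_trans q1)// ltry.
Unshelve. all: end_near.
Qed.

Lemma C_omega_continuous f : C_omega omega f -> continuous (f \o clamp01).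
Proof.
move=> /C_omega_bound[K K0 fK] x; apply/cvgrPdist_lt => e e0.
have K1 : 0 < K + 1 by rewrite ltr_wpDl.
have [d d0 Hd] := modulus_fine_small (divr_gt0 e0 K1).
apply/nbhs_ballP; exists d => // y xyd /=.
set t := `|(clamp01 x)%:num - (clamp01 y)%:num|.
have td : 0 <= t < d by rewrite normr_ge0 (le_lt_trans (dist_clamp01 _ _)).
have wt : w t < e / (K + 1) by rewrite Hd// dist01_le1.
have w0 : 0 <= w t by rewrite modulus_fine_ge0// normr_ge0 dist01_le1.
apply: (le_lt_trans (fK _ _)); rewrite -/t.
apply: (@le_lt_trans _ _ ((K + 1) * w t)); first by rewrite ler_wpM2r// lerDl.
by rewrite mulrC -ltr_pdivlMr.
Qed.

Lemma omega_dist_le (f g : little_space omega) (a b : R) :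
  (forall x, `|f x - g x| <= a) ->
  (forall x y, `|(f x - g x) - (f y - g y)| <= b * w `|x%:num - y%:num|) ->
  omega_dist f g <= a + b.
Proof.
move=> fga fgb; rewrite -lee_fin omega_distE EFinD; apply: leeD.
  by apply: ge_ereal_sup => _ [x _ <-]; rewrite lee_fin; exact: fga.
exact: omega_seminorm_le.
Qed.

Lemma dist_le_omega_dist (f g : little_space omega) x :
  `|f x - g x| <= omega_dist f g.
Proof.
rewrite -lee_fin omega_distE; apply: (@le_trans _ _ (sup_norm (f \- g))).
  by apply: ereal_sup_ubound; exists x.
by rewrite leeDl// omega_seminorm_ge0.
Qed.

(** For [0 < t < 1], [w t] is exactly [t] to the power [log_ratio omega t]; a base below 1 reverses
    the order of exponents. *)
Lemma modulus_log_ratio (eta e : R) :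
  log_ratio omega t @[t --> 0^'+] --> eta -> 0 < e ->
  \forall t \near 0^'+, t `^ (eta + e) <= w t <= t `^ (eta - e).
Proof.
move=> /cvgrPdist_le le_eta e0; near=> t.
have t0 : 0 < t by near: t; exact: nbhs_right_gt.
have t1 : t < 1 by near: t; exact: nbhs_right_lt.
have : `|eta - log_ratio omega t| <= e by near: t; exact: le_eta.
have w0 : 0 < w t by rewrite modulus_fine_gt0// t0 ltW.
have lnt : ln t < 0 by rewrite ln_lt0// t0.
have wE : w t = t `^ (log_ratio omega t).
  by rewrite /log_ratio /powR gt_eqF// divfK ?lt_eqF// lnK.
rewrite wE ler_norml => /andP[? ?]; apply/andP; split.
  by apply: ger_powR; rewrite ?t0 ?(ltW t1)//; lra.
by apply: ger_powR; rewrite ?t0 ?(ltW t1)//; lra.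
Unshelve. all: end_near.
Qed.

End modulus_theory.

(** * Density of Lipschitz functions *)

Section lipschitz_approximation.
Context {R : realType} (omega : modulus R) (conc : concave_on01 omega).
Implicit Types (f : {i01 R} -> R) (x y : {i01 R}) (s t d e c L M : R).

Local Notation w t := (fine (omega t)).

(* Infimal convolution over the whole line of the constant extension of [f];
   extending first makes translations, hence moduli of continuity, available. *)
Definition inf_convolution f L x : R :=
  inf [set f (clamp01 (x%:num + s)) + L * `|s| | s in [set: R]].

Lemma inf_convolution_le f L M x s : 0 <= L -> (forall x, `|f x| <= M) ->
  inf_convolution f L x <= f (clamp01 (x%:num + s)) + L * `|s|.
Proof.
move=> L0 fM; apply: ge_inf; last by exists s.
exists (- M) => _ [u _ <-]; have := fM (clamp01 (x%:num + u)).
by rewrite ler_norml => /andP[? _]; rewrite ler_wpDr// mulr_ge0.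
Qed.

Lemma le_inf_convolution f L x c :
  (forall s, c <= f (clamp01 (x%:num + s)) + L * `|s|) ->
  c <= inf_convolution f L x.
Proof.
move=> h; apply: lb_le_inf; last by move=> _ [s _ <-].
by exists (f (clamp01 (x%:num + 0)) + L * `|0 : R|); exists 0.
Qed.

(** A shift [s] from [y] and the shift [y - x + s] from [x] reach the same point, and their costs
    differ by at most [L * |x - y|]. *)
Lemma inf_convolution_lipschitz f L M x y : 0 <= L -> (forall x, `|f x| <= M) ->
  `|inf_convolution f L x - inf_convolution f L y| <= L * `|x%:num - y%:num|.
Proof.
move=> L0 fM; wlog suff h : x y /
    inf_convolution f L x - inf_convolution f L y <= L * `|x%:num - y%:num|.
  rewrite ler_norml h andbT lerNl opprB distrC; exact: h.
rewrite lerBlDr -lerBlDl; apply: le_inf_convolution => s; rewrite lerBlDl.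
apply: (le_trans (@inf_convolution_le _ _ _ _ (y%:num - x%:num + s) L0 fM)).
rewrite addrA subrKC addrCA lerD2l -mulrDr ler_wpM2l// distrC.
exact: ler_normD.
Qed.

(** Here the same shift is used at both points: the costs cancel, and clamping does not increase the
    distance of the shifted points. *)
Lemma inf_convolution_osc f L M d e x y : 0 <= L -> 0 <= e ->
  (forall x, `|f x| <= M) ->
  (forall x y, `|x%:num - y%:num| <= d ->
    `|f x - f y| <= e * w `|x%:num - y%:num|) ->
  `|x%:num - y%:num| <= d ->
  `|inf_convolution f L x - inf_convolution f L y| <= e * w `|x%:num - y%:num|.
Proof.
move=> L0 e0 fM fd; wlog suff h : x y / `|x%:num - y%:num| <= d ->
    inf_convolution f L x - inf_convolution f L y <= e * w `|x%:num - y%:num|.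
  move=> xyd; rewrite ler_norml h// andbT lerNl opprB distrC; apply: h.
  by rewrite distrC.
move=> xyd.
rewrite lerBlDr -lerBlDl; apply: le_inf_convolution => s; rewrite lerBlDl.
apply: (le_trans (@inf_convolution_le _ _ _ _ s L0 fM)).
rewrite addrA lerD2r -lerBlDr.
have c01 := dist_clamp01 (x%:num + s) (y%:num + s).
have E : x%:num + s - (y%:num + s) = x%:num - y%:num by ring.
rewrite E in c01.
apply: (le_trans (ler_norm _)); apply: (le_trans (fd _ _ (le_trans c01 xyd))).
by rewrite ler_wpM2l// modulus_fine_nd// dist01_le1.
Qed.

(** A shift longer than [d] costs at least [2 * M], more than [f] can drop; a shorter one changes
    [f] by at most [e * w d]. *)
Lemma inf_convolution_near f L M d e x : 0 <= L -> 0 <= e -> 0 < d <= 1 ->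
  M + M <= L * d -> (forall x, `|f x| <= M) ->
  (forall x y, `|x%:num - y%:num| <= d ->
    `|f x - f y| <= e * w `|x%:num - y%:num|) ->
  f x - e * w d <= inf_convolution f L x <= f x.
Proof.
move=> L0 e0 /andP[d0 d1] MLd fM fd; apply/andP; split; last first.
  have := @inf_convolution_le f L M x 0 L0 fM.
  by rewrite addr0 clamp01K normr0 mulr0 addr0.
apply: le_inf_convolution => s.
have wd : 0 <= e * w d by rewrite mulr_ge0// modulus_fine_ge0// (ltW d0).
have [sd|ds] := leP `|s| d.
  have cd : `|x%:num - (clamp01 (x%:num + s))%:num| <= d.
    rewrite -{1}(clamp01K x); apply: le_trans (dist_clamp01 _ _) _.
    by rewrite opprD addrA subrr sub0r normrN.
  apply: (@le_trans _ _ (f (clamp01 (x%:num + s)))); last by rewrite lerDl mulr_ge0.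
  rewrite lerBlDr -lerBlDl; apply: (le_trans (ler_norm _)).
  by apply: (le_trans (fd _ _ cd)); rewrite ler_wpM2l// modulus_fine_nd.
have := fM x; have := fM (clamp01 (x%:num + s)).
rewrite !ler_norml => /andP[h1 _] /andP[_ h2].
have : L * d <= L * `|s| by rewrite ler_wpM2l// ltW.
by move: (L * `|s|) (L * d) MLd => a b; lra.
Qed.

Lemma c_omega_bounded f : c_omega omega f -> exists M, forall x, `|f x| <= M.
Proof.
move=> [/(C_omega_bound conc)[K K0 fK] _]; exists (`|f 0%:i01| + K * w 1) => x.
rewrite -[X in `|X| <= _](subrK (f 0%:i01)) addrC.
apply: (le_trans (ler_normD _ _)); rewrite lerD2l; apply: (le_trans (fK _ _)).
by rewrite ler_wpM2l// modulus_fine_nd// dist01_le1.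
Qed.

(** Up to distance [d], [f] and its inf-convolution both have quotients at most [e']; beyond [d],
    the uniform error [e' * w d] is already small compared with [w]. *)
Lemma lipschitz_dense f e : c_omega omega f -> 0 < e ->
  exists p L, [/\ 0 <= L,
    forall x y, `|p x - p y| <= L * `|x%:num - y%:num|,
    forall x, `|f x - p x| <= e &
    forall x y, `|(f x - p x) - (f y - p y)| <= e * w `|x%:num - y%:num|].
Proof.
move=> fc e0; have [M fM] := c_omega_bounded fc.
have M0 : 0 <= M by apply: le_trans (fM 0%:i01).
have w1 : 0 < w 1 by rewrite modulus_fine_gt0// ltr01 lexx.
(* Chosen so that both [e' * w 1] and [2 * e'] are at most [e]. *)
pose e' := e / (2 + w 1).
have W0 : 0 < 2 + w 1 by rewrite addr_gt0.
have e'0 : 0 < e' by rewrite divr_gt0.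
have e'w : e' * w 1 <= e.
  by rewrite /e' mulrAC ler_pdivrMr// ler_pM2l// lerDr.
have e'2 : e' + e' <= e.
  by rewrite -mulr2n -mulr_natr /e' mulrAC ler_pdivrMr// ler_pM2l// lerDl ltW.
have [d' d'0 Hd'] := c_omega_osc conc fc e'0.
pose d := Num.min d' 1.
have d01 : 0 < d <= 1 by rewrite lt_min d'0 ltr01 ge_min lexx orbT.
have /andP[d0 d1] := d01.
have Hd x y : `|x%:num - y%:num| <= d -> `|f x - f y| <= e' * w `|x%:num - y%:num|.
  by move=> xyd; apply: Hd'; rewrite (le_trans xyd)// ge_min lexx.
pose L := (M + M) / d.
have L0 : 0 <= L by rewrite divr_ge0 ?addr_ge0// ltW.
have MLd : M + M <= L * d by rewrite divfK// gt_eqF.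
pose p := inf_convolution f L.
have fp x : 0 <= f x - p x <= e' * w d.
  have := inf_convolution_near x L0 (ltW e'0) d01 MLd fM Hd.
  by rewrite -/(p x) => /andP[? ?]; apply/andP; split; lra.
exists p, L; split=> //.
- by move=> x y; exact: (@inf_convolution_lipschitz _ _ M).
- move=> x; have /andP[? h] := fp x; rewrite ger0_norm//.
  apply: (le_trans h); apply: le_trans e'w.
  by rewrite ler_wpM2l ?(ltW e'0)// modulus_fine_nd// ltW.
- move=> x y; have [xyd|dxy] := leP `|x%:num - y%:num| d.
    have := inf_convolution_osc L0 (ltW e'0) fM Hd xyd; rewrite -/(p x) -/(p y).
    have := Hd _ _ xyd => h1 h2.
    have -> : f x - p x - (f y - p y) = (f x - f y) - (p x - p y) by ring.
    apply: (le_trans (ler_normB _ _)); apply: (le_trans (lerD h1 h2)).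
    by rewrite -mulrDl ler_wpM2r// modulus_fine_ge0// normr_ge0 dist01_le1.
  have /andP[? ?] := fp x; have /andP[? ?] := fp y.
  (* Both errors lie in [[0, e' * w d]], hence so does the absolute value of their difference. *)
  apply: (@le_trans _ _ (e' * w d)); first by rewrite ler_norml; lra.
  have wdxy : w d <= w `|x%:num - y%:num|.
    by apply: modulus_fine_nd; rewrite ?(ltW d0) ?(ltW dxy) ?dist01_le1.
  apply: ler_pM; rewrite ?(ltW e'0)//.
    by rewrite modulus_fine_ge0// (ltW d0).
  by apply: le_trans e'2; rewrite lerDl ltW.
Qed.

(** The quotient at distance [t] is at most [L * t / w t], which tends to 0 when [t] is negligible
    against [w t]. *)
Lemma lipschitz_c_omega f L :
  (forall e, 0 < e -> \forall t \near 0^'+, t <= e * w t) -> 0 <= L ->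
  (forall x y, `|f x - f y| <= L * `|x%:num - y%:num|) -> c_omega omega f.
Proof.
move=> sublin L0 fL; apply: (@c_omegaI _ _ conc _ (`|f 0%:i01| + L)).
  move=> x; rewrite -[X in `|X| <= _](subrK (f 0%:i01)) addrC.
  apply: (le_trans (ler_normD _ _)); rewrite lerD2l; apply: (le_trans (fL _ _)).
  by rewrite ler_piMr// dist01_le1.
move=> e e0; have L1 : 0 < L + 1 by rewrite ltr_wpDl.
have [d /= d0 Hd] := sublin _ (divr_gt0 e0 L1).
exists (d / 2) => [|x y xyd]; first by rewrite divr_gt0.
have [->|/eqP xy] := eqVneq x y.
  by rewrite !subrr !normr0 modulus_fine0 mulr0.
have /andP[t0 t1] := dist01P xy.
have : `|x%:num - y%:num| <= e / (L + 1) * w `|x%:num - y%:num|.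
  by apply: Hd => //=; rewrite sub0r normrN normr_id; lra.
rewrite mulrAC ler_pdivlMr// => h; apply: (le_trans (fL _ _)).
by apply: le_trans h; rewrite mulrC ler_wpM2l// lerDl.
Qed.

End lipschitz_approximation.

(** * The tent wave *)

Section tent.
Context {R : realType}.
Implicit Types (u v : R) (N j : nat).

(** Distance to the first [N] multiples of 4, capped at 1. The rising stretches [[4 * j, 4 * j + 1]]
    are 3 apart, so after scaling by [r] different stretches are more than [2 * r] apart. *)
Definition tent N u : R := \big[Num.min/1]_(k < N) `|u - 4 * k%:R|.

Lemma tent_ge0 N u : 0 <= tent N u.
Proof. by apply: le_bigmin => // i _. Qed.

Lemma tent_le1 N u : tent N u <= 1.
Proof. exact: bigmin_le_id. Qed.

Lemma tent_lipschitz N u v : `|tent N u - tent N v| <= `|u - v|.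
Proof.
wlog suff h : u v / tent N u <= tent N v + `|u - v|.
  by rewrite ler_norml; have := h u v; have := h v u; rewrite (distrC v); lra.
rewrite -lerBlDr; apply: le_bigmin => [|k _].
  by rewrite lerBlDr (le_trans (tent_le1 _ _))// lerDl.
rewrite lerBlDr; apply: (@le_trans _ _ `|u - 4 * k%:R|).
  exact: bigmin_le_cond.
by rewrite -(subrKA v) [leRHS]addrC ler_normD.
Qed.

Lemma tent_even N j : (j < N)%N -> tent N (4 * j%:R) = 0.
Proof.
move=> jN; apply/eqP; rewrite eq_le tent_ge0 andbT.
have z : `|4 * j%:R - 4 * (Ordinal jN)%:R| = 0 :> R by rewrite subrr normr0.
by rewrite -[leRHS]z; exact: bigmin_le_cond.
Qed.

Lemma tent_odd N j : tent N (4 * j%:R + 1) = 1.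
Proof.
apply/eqP; rewrite eq_le tent_le1/=; apply: le_bigmin => // k _.
rewrite leNgt; apply/negP; rewrite ltr_norml => /andP[h1 h2].
have [jk|kj] := ltnP j k.
  have : j%:R + 1 <= k%:R :> R by rewrite natr1 ler_nat.
  by lra.
have : k%:R <= j%:R :> R by rewrite ler_nat.
by lra.
Qed.

End tent.

(** * Typical graphs *)

Section typical_graphs.
Context {R : realType}.
Implicit Types (h : {i01 R} -> R) (r rho V l theta eta nu : R).

(** On each rising stretch [h] takes the values [3 * r * i] above its starting height. The resulting
    points, indexed by [(j, i)], are separated horizontally if [j] differs and vertically otherwise.
    The bounds [rho / 8] and [rho / 4] keep them in the ball. *)
Lemma packing_zigzag h r rho l V :
  continuous (h \o clamp01) -> 0 < r -> 8 * r <= rho -> rho <= 1 ->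
  0 <= l <= rho / 8 -> 0 <= V ->
  (forall j : nat, 4 * j%:R * r <= l ->
    `|h (clamp01 (4 * j%:R * r)) - h (clamp01 0)| <= rho / 4 /\
    V <= h (clamp01 ((4 * j%:R + 1) * r)) - h (clamp01 (4 * j%:R * r))) ->
  ((l / (4 * r) * (Num.min V (rho / 4) / (3 * r)))%:E <=
    packing_number r (open_eball (graph_point h (clamp01 0)) rho `&` graph h))%E.
Proof.
move=> hc r0 rrho rho1 /andP[l0 lrho] V0 hj.
set m := Num.min V (rho / 4).
have m0 : 0 <= m by rewrite le_min V0 divr_ge0//; lra.
have r4 : 0 < 4 * r by rewrite mulr_gt0.
have r3 : 0 < 3 * r by rewrite mulr_gt0.
(* Indices start at 0, so there are [J.+1] columns and [I.+1] heights, and truncation loses nothing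
   in the lower bound. *)
pose J := Num.truncn (l / (4 * r)); pose I := Num.truncn (m / (3 * r)).
have jJ (j : 'I_J.+1) : 4 * j%:R * r <= l.
  have : (j%:R : R) <= l / (4 * r).
    by rewrite -truncn_ge_nat ?divr_ge0 ?(ltW r4)// -ltnS.
  by rewrite ler_pdivlMr//; lra.
have iI (i : 'I_I.+1) : 3 * r * i%:R <= m.
  have : (i%:R : R) <= m / (3 * r).
    by rewrite -truncn_ge_nat ?divr_ge0 ?(ltW r3)// -ltnS.
  by rewrite ler_pdivlMr//; lra.
have /choice[y yP] : forall k : 'I_J.+1 * 'I_I.+1, exists y,
    4 * k.1%:R * r <= y <= (4 * k.1%:R + 1) * r /\
    h (clamp01 y) = h (clamp01 (4 * k.1%:R * r)) + 3 * r * k.2%:R.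
  move=> [j i] /=; have [_ hV] := hj j (jJ j).
  have [|||y] := @IVT _ (h \o clamp01) (4 * j%:R * r) ((4 * j%:R + 1) * r)
      (h (clamp01 (4 * j%:R * r)) + 3 * r * i%:R).
  - by lra.
  - exact: continuous_subspaceT.
  - rewrite ge_min le_max /=; apply/andP; split; apply/orP; [left|right].
      by rewrite lerDl mulr_ge0 ?(ltW r3).
    have := iI i; rewrite le_min => /andP[iV _]; lra.
  - by rewrite in_itv/= => yj hy; exists y.
have y01 k : 0 <= y k <= 1.
  have [/andP[h1 h2] _] := yP k; have := jJ k.1.
  have : 0 <= 4 * k.1%:R * r by rewrite !mulr_ge0// ltW.
  by move=> ? ?; apply/andP; split; lra.
apply: le_trans (@packing_number_ge _ _ (fun k => graph_point h (clamp01 (y k)))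
  r _ _ _).
- rewrite card_prod !card_ord lee_fin natrM; apply: ler_pM.
  + by rewrite divr_ge0// ltW.
  + by rewrite divr_ge0// ltW.
  + exact/ltW/truncnS_gt.
  + exact/ltW/truncnS_gt.
- move=> k; split; last exact: graph_graph_point.
  have [/andP[yl yu] hy] := yP k; have [hk _] := hj _ (jJ k.1).
  have := jJ k.1; have := y01 k; move=> /andP[y0 y1] jl.
  apply: edist2_lt; first lra.
    rewrite !graph_point0 !clamp01_id ?lexx ?ler01 ?y0// sub0r normrN ger0_norm//.
    by lra.
  rewrite !graph_point1 hy distrC addrAC (le_trans (ler_normD _ _))//.
  have := iI k.2; rewrite le_min => /andP[_ irho].
  by rewrite [`|3 * r * _|]ger0_norm ?mulr_ge0// ?(ltW r3)//; lra.
- move=> k k' kk'.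
  have [/andP[yl yu] hy] := yP k; have [/andP[yl' yu'] hy'] := yP k'.
  have nat_sep (a b : nat) : (a < b)%N -> a%:R + 1 <= b%:R :> R.
    by move=> ab; rewrite natr1 ler_nat.
  have [e1|] := eqVneq k.1 k'.1; last first.
    rewrite -val_eqE /= neq_ltn => kk1; exists 0.
    rewrite !graph_point0 !clamp01_id// lter_normr.
    case/orP: kk1 => /nat_sep; move: (k.1%:R : R) (k'.1%:R : R) yl yu yl' yu'.
      by move=> a b *; apply/orP; right; nra.
    by move=> a b *; apply/orP; left; nra.
  have : k.2 != k'.2.
    by apply: contraNneq kk' => e2; rewrite [k]surjective_pairing e1 e2 -surjective_pairing.
  rewrite -val_eqE /= neq_ltn => kk2; exists 1.
  rewrite !graph_point1 hy hy' e1 opprD addrACA subrr add0r lter_normr.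
  case/orP: kk2 => /nat_sep; move: (k.2%:R : R) (k'.2%:R : R).
    by move=> a b ab; apply/orP; right; nra.
  by move=> a b ab; apply/orP; left; nra.
Qed.

Lemma typical_of_dense (T : pseudoMetricType R) (A : nat -> set T) (P : T -> Prop) :
  (forall n f e, 0 < e -> exists g d,
    [/\ 0 < d, ball f e g & ball g d `<=` A n]) ->
  (forall f, (forall n, A n f) -> P f) -> typical P.
Proof.
move=> dA AP; exists (fun n => ~` A n `&` ~` [set x | P x]); split=> [n|].
  apply/seteqP; split=> // f /nbhs_ballP[e /= e0 fe].
  have [g [d [d0 fg gA]]] := dA n f e e0.
  have [z [[zA _] gz]] := fe _ fg _ (nbhsx_ballx g d d0).
  exact: zA (gA _ gz).
apply/seteqP; split=> [f nP|f [n _ []//]].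
have /existsNP[n nA] : ~ forall n, A n f by move=> /AP.
by exists n.
Qed.

(* All [theta] are served by one common scale [r]; this is what makes the
   typical dimension formula hold for all [theta] simultaneously. *)
Definition wiggly eta nu h := exists2 r, 0 < r < nu &
  forall theta, 0 < theta < 1 -> 8 * r <= r `^ theta ->
  ((r `^ nu * r `^ nu * (r `^ theta / r * (r `^ (Num.max eta theta) / r)))%:E <=
    packing_number r
      (open_eball (graph_point h (clamp01 0)) (r `^ theta) `&` graph h))%E.

(** By [ratio_powR] the power of [r ^ theta / r] to be reached is the main factor of the count in
    [wiggly]; the loss [r ^ (2 * nu)] is harmless for [nu <= e / 2]. *)
Lemma assouad_spectrum_wiggly_ge h eta theta : eta < 1 -> 0 < theta < 1 ->
  (forall n, wiggly eta n.+1%:R^-1 h) ->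
  ((1 + (1 - Num.max eta theta) / (1 - theta))%:E <=
    assouad_spectrum theta (graph h))%E.
Proof.
move=> eta1 /andP[t0 t1] hh; apply: assouad_spectrum_ge; first by rewrite t0.
(* [r < u] means [r ^ (1 - theta) < 1 / 8], giving the side condition of [wiggly]. *)
move=> e e0; pose u := (8^-1 : R) `^ (1 - theta)^-1.
have t1' : 0 < 1 - theta by rewrite subr_gt0.
have u0 : 0 < u by rewrite powR_gt0// invr_gt0.
pose m := Num.min 1 (Num.min (e / 2) u).
have m0 : 0 < m by rewrite !lt_min ltr01 u0 divr_gt0.
pose n := Num.truncn m^-1.
have nm : n.+1%:R^-1 <= m.
  by rewrite -[leRHS]invrK lef_pV2 ?posrE ?invr_gt0 ?ltr0n// ltW// truncnS_gt.
have [r /andP[r0 rn] hr] := hh n.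
have nu0 : 0 < n.+1%:R^-1 :> R by rewrite invr_gt0 ltr0n.
move: nm nu0 rn hr; move: (n.+1%:R^-1 : R) => nu num nu0 rn hr.
have := lt_le_trans rn num; rewrite !lt_min => /and3P[r1 re ru].
exists r, (graph_point h (clamp01 0)); split.
- by rewrite r0; lra.
- exact: graph_graph_point.
have r8 : 8 * r <= r `^ theta.
  have : r `^ (1 - theta) <= 8^-1.
    have -> : 8^-1 = u `^ (1 - theta) by rewrite -powRrM mulVf ?gt_eqF// powRr1// invr_ge0.
    by apply: ge0_ler_powR; rewrite ?nnegrE ?(ltW t1') ?(ltW r0) ?(ltW u0) ?(ltW ru).
  by rewrite powRB_gt0// powRr1 ?(ltW r0)// ler_pdivrMr ?powR_gt0//; lra.
have t01 : 0 < theta < 1 by rewrite t0.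
apply: le_trans (hr theta t01 r8); rewrite lee_fin.
have rr1 : 0 < r `^ theta / r by rewrite divr_gt0 ?powR_gt0.
rewrite powRD_gt0// powRr1 ?(ltW rr1)// ratio_powR ?lt_eqF// opprB.
rewrite [X in _ * (_ * X)]powRB_gt0// powRr1 ?(ltW r0)//.
rewrite ler_wpM2r ?mulr_ge0 ?invr_ge0 ?powR_ge0 ?(ltW r0)//.
rewrite -powRD_gt0//; apply: ger_powR; first by rewrite r0 ltW.
have : nu <= e / 2 by rewrite (le_trans num)// /m !ge_min lexx !orbT.
by lra.
Qed.

End typical_graphs.

(** * Density of wiggly functions *)

Section little_space_wiggly.
Context {R : realType} (omega : modulus R) (conc : concave_on01 omega).
Context (eta : R) (omega_eta : log_ratio omega t @[t --> 0^'+] --> eta).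
Context (eta1 : eta < 1).

Local Notation w t := (fine (omega t)).

(** With [k = (1 - eta) / 2], eventually [w t >= t ^ (eta + k) = t ^ (1 - k)], so
    [t <= t ^ k * w t]. *)
Lemma modulus_superlinear (e : R) : 0 < e -> \forall t \near 0^'+, t <= e * w t.
Proof.
move=> e0; pose k := (1 - eta) / 2; have k0 : 0 < k by rewrite divr_gt0// subr_gt0.
near=> t.
have t0 : 0 < t by near: t; exact: nbhs_right_gt.
have tk : t `^ k <= e.
  near: t; have /cvgrPdist_le/(_ e e0) := powR_cvg0 k0.
  apply: filterS => t; rewrite sub0r normrN; apply: le_trans; exact: ler_norm.
have : t `^ (eta + k) <= w t <= t `^ (eta - k).
  by near: t; exact: (modulus_log_ratio conc omega_eta k0).
move=> /andP[h _].
apply: (@le_trans _ _ (t `^ k * t `^ (eta + k))).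
  rewrite -powRD_gt0// [X in _ `^ X](_ : _ = 1) ?powRr1 ?(ltW t0)//.
  by rewrite /k; field.
by apply: ler_pM => //; exact: powR_ge0.
Unshelve. all: end_near.
Qed.

Lemma wiggly_dense (f : little_space omega) (e nu : R) : 0 < e -> 0 < nu ->
  exists (g : little_space omega) d, [/\ 0 < d, omega_dist f g < e &
    forall h : little_space omega, omega_dist g h < d -> wiggly eta nu h].
Proof.
move=> e0 nu0.
have e4 : 0 < e / 8 by rewrite divr_gt0.
have [p [L [L0 pL fp1 fp2]]] := lipschitz_dense conc (little_funP f) e4.
have w1 : 0 < w 1 by rewrite modulus_fine_gt0// ltr01 lexx.
have W0 : 0 < w 1 + 1 by rewrite addr_gt0.
(* Relative height of the wave: its sup norm is at most [dl * w 1] and its seminorm at most [dl],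
   both below [e / 4]. *)
have [dl [dl0 dl1 dlw]] : exists dl, [/\ 0 < dl, dl <= 1 &
    dl * (w 1 + 1) <= e / 4].
  exists (Num.min 1 (e / 4 / (w 1 + 1))); split.
  - by rewrite lt_min ltr01 !divr_gt0.
  - by rewrite ge_min lexx.
  - by rewrite -ler_pdivlMr// ge_min lexx orbT.
(* All constants of the final count: [dl / 4] from the height, [8 * (L + 1)] from [l], and 12 from
   [4 * r] times [3 * r]. *)
pose c := dl / (4 * (8 * (12 * (L + 1)))).
have L1 : 0 < L + 1 by rewrite ltr_wpDl.
have c0 : 0 < c by rewrite divr_gt0// !mulr_gt0//.
have c0' : 0 < dl / (2 * (L + 1)) by rewrite divr_gt0// mulr_gt0.
have : \forall r \near (0 : R)^'+, [/\ 0 < r < nu, r < 1, r `^ (eta + nu) <= w r,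
    r <= dl / (2 * (L + 1)) * w r & r `^ nu <= c].
  near=> r; split.
  - by apply/andP; split; near: r; [exact: nbhs_right_gt|exact: nbhs_right_lt].
  - by near: r; exact: nbhs_right_lt.
  - have : r `^ (eta + nu) <= w r <= r `^ (eta - nu).
      by near: r; exact: (modulus_log_ratio conc omega_eta nu0).
    by case/andP.
  - by near: r; exact: modulus_superlinear.
  - near: r; have /cvgrPdist_le/(_ c c0) := powR_cvg0 nu0.
    apply: filterS => t; rewrite sub0r normrN; apply: le_trans; exact: ler_norm.
move=> /filter_ex[r [/andP[r0 rnu] r1 rw rL rc]].
have r01 : 0 < r <= 1 by rewrite r0 ltW.
have wr0 : 0 < w r by exact: modulus_fine_gt0.
have wr1 : w r <= w 1 by apply: modulus_fine_nd; rewrite ?(ltW r0) ?(ltW r1).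
(* Enough teeth to cover the unit interval. *)
pose N := (Num.truncn r^-1).+1.
pose z (x : {i01 R}) := dl * w r * tent N (x%:num / r).
have z_le x : `|z x| <= e / 4.
  rewrite /z ger0_norm ?mulr_ge0 ?tent_ge0 ?(ltW dl0) ?(ltW wr0)//.
  apply: le_trans dlw; rewrite -mulrA ler_pM2l//.
  apply: (@le_trans _ _ (w r)); first by rewrite ler_piMr ?tent_le1// ltW.
  by rewrite (le_trans wr1)// lerDl.
have z_lip x y : `|z x - z y| <= dl * w r / r * `|x%:num - y%:num|.
  rewrite -mulrBr normrM ger0_norm ?mulr_ge0 ?(ltW dl0) ?(ltW wr0)// -mulrA.
  rewrite ler_wpM2l ?mulr_ge0 ?(ltW dl0) ?(ltW wr0)//.
  apply: (le_trans (tent_lipschitz _ _ _)); rewrite -mulrBl normrM mulrC.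
  by rewrite gtr0_norm// invr_gt0.
have z_w x y : `|z x - z y| <= e / 4 * w `|x%:num - y%:num|.
  set t := `|x%:num - y%:num|.
  have t1 : t <= 1 by exact: dist01_le1.
  have wt0 : 0 <= w t by rewrite modulus_fine_ge0// normr_ge0 t1.
  apply: (@le_trans _ _ (dl * w t)); last first.
    rewrite ler_wpM2r//; apply: le_trans dlw.
    by rewrite ler_peMr ?(ltW dl0)// lerDr ltW.
  (* Up to distance [r] the slope [dl * w r / r] is controlled by concavity; beyond [r] the height
     [dl * w r] is, by monotonicity. *)
  have [tr|rt] := leP t r.
    apply: (le_trans (z_lip _ _)).
    have -> : dl * w r / r * t = dl * (t / r * w r) by ring.
    rewrite ler_wpM2l ?(ltW dl0)//.
    exact: (modulus_fine_ratio conc (normr_ge0 _) tr (ltW r1) r0).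
  rewrite -mulrBr normrM ger0_norm ?mulr_ge0 ?(ltW dl0) ?(ltW wr0)// -mulrA.
  rewrite ler_wpM2l ?(ltW dl0)//.
  apply: (@le_trans _ _ (w r)).
    rewrite ler_piMr ?(ltW wr0)// ler_norml.
    have := tent_ge0 N (x%:num / r); have := tent_le1 N (x%:num / r).
    have := tent_ge0 N (y%:num / r); have := tent_le1 N (y%:num / r).
    by move=> *; apply/andP; split; lra.
  by apply: modulus_fine_nd; rewrite ?(ltW r0) ?(ltW rt).
pose g0 x := p x + z x.
have g0L x y : `|g0 x - g0 y| <= (L + dl * w r / r) * `|x%:num - y%:num|.
  have -> : g0 x - g0 y = (p x - p y) + (z x - z y) by rewrite /g0; ring.
  rewrite mulrDl; exact: le_trans (ler_normD _ _) (lerD (pL x y) (z_lip x y)).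
have L'0 : 0 <= L + dl * w r / r.
  by rewrite addr_ge0// divr_ge0 ?mulr_ge0 ?(ltW dl0) ?(ltW wr0) ?(ltW r0).
have g0c : c_omega omega g0 := lipschitz_c_omega conc modulus_superlinear L'0 g0L.
pose g := LittleSpace g0c.
exists g, (r / 2); split; first by rewrite divr_gt0.
  apply: (@le_lt_trans _ _ ((e / 8 + e / 4) + (e / 8 + e / 4))); last by lra.
  apply: (omega_dist_le conc) => [x|x y] /=.
    have -> : f x - g0 x = (f x - p x) - z x by rewrite /g0; ring.
    exact: le_trans (ler_normB _ _) (lerD (fp1 x) (z_le x)).
  have -> : f x - g0 x - (f y - g0 y) =
    (f x - p x - (f y - p y)) - (z x - z y) by rewrite /g0; ring.
  rewrite mulrDl; exact: le_trans (ler_normB _ _) (lerD (fp2 x y) (z_w x y)).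
move=> h gh; exists r; first by rewrite r0.
move=> theta /andP[t0 t1] r8; set rho := r `^ theta in r8 *.
have rho0 : 0 < rho by exact: powR_gt0.
have rho1 : rho <= 1 by rewrite -(powRr0 r); apply: ger_powR; rewrite ?r0 ltW.
have gh' x : `|g0 x - h x| <= r / 2.
  exact: le_trans (dist_le_omega_dist g h x) (ltW gh).
(* Over length [l] the Lipschitz part drifts by at most [rho / 8], so the columns stay in the
   ball. *)
pose l := rho / (8 * (L + 1)).
have l0 : 0 <= l by rewrite divr_ge0 ?mulr_ge0 ?(ltW rho0) ?(ltW L1).
have lL : l * (L + 1) = rho / 8.
  by rewrite /l; field; rewrite gt_eqF.
have l8 : l <= rho / 8 by rewrite -lL ler_peMr// lerDr.
have V0 : 0 <= dl * w r / 2 by rewrite divr_ge0// mulr_ge0// ltW.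
(* Along a rising stretch [p] costs at most [L * r] and the perturbation at most [r / 2] at each
   end, so half of the rise survives. *)
have rLw : (L + 1) * r <= dl * w r / 2.
  move: rL; rewrite mulrAC ler_pdivlMr ?mulr_gt0//; lra.
have hc : continuous (h \o clamp01).
  by apply: (C_omega_continuous conc); case: (little_funP h).
apply: le_trans (@packing_zigzag _ h r rho l (dl * w r / 2) hc r0 r8 rho1 _ V0 _).
- rewrite lee_fin; set Y := r `^ Num.max eta theta.
  have Y0 : 0 < Y by exact: powR_gt0.
  have rnu1 : r `^ nu <= 1 by rewrite -(powRr0 r); apply: ger_powR; rewrite ?r01 ?ltW.
  (* One factor [r ^ nu] absorbs the gap between [w r] and [r ^ eta]; the other absorbs [c]. *)
  have Yw : r `^ nu * Y <= w r.
    apply: le_trans rw; rewrite -powRD_gt0//; apply: ger_powR => //.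
    by rewrite addrC lerD2l le_max lexx.
  have Yrho : r `^ nu * Y <= rho.
    apply: (@le_trans _ _ Y); first by rewrite ler_piMl// ltW.
    by apply: ger_powR => //; rewrite le_max lexx orbT.
  have Ym : dl / 4 * (r `^ nu * Y) <= Num.min (dl * w r / 2) (rho / 4).
    have nuY0 : 0 < r `^ nu * Y by rewrite mulr_gt0 ?powR_gt0.
    rewrite le_min; move: (r `^ nu * Y) Yw Yrho nuY0 => q qw qrho q_gt0.
    have wq : dl * q <= dl * w r by rewrite ler_wpM2l// ltW.
    have rq : dl * q <= q by rewrite ler_piMl// ltW.
    clear - wq rq qw qrho V0 q_gt0 rho0 wr0 dl0.
    by apply/andP; split; lra.
  have r3 : 0 <= (3 * r)^-1 by rewrite invr_ge0 mulr_ge0// ltW.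
  have r4 : 0 <= l / (4 * r) by rewrite (divr_ge0 l0)// mulr_ge0// ltW.
  apply: (@le_trans _ _ (c * (r `^ nu * (rho / r * (Y / r))))).
    rewrite -mulrA ler_wpM2r// !mulr_ge0 ?powR_ge0 ?invr_ge0 ?(ltW r0)//.
  apply: le_trans (ler_wpM2l r4 (ler_wpM2r r3 Ym)).
  rewrite le_eqVlt; apply/orP; left; apply/eqP; rewrite /c /l; field.
  by rewrite !gt_eqF.
- by rewrite l0 l8.
move=> j jl.
have jr0 : 0 <= 4 * j%:R * r by rewrite !mulr_ge0// ltW.
have jN : (j < N)%N.
  rewrite ltnS truncn_ge_nat ?invr_ge0 ?(ltW r0)// -[leRHS]mul1r ler_pdivlMr//.
  by lra.
have x01 : 0 <= 4 * j%:R * r <= 1 by rewrite jr0; lra.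
have y01 : 0 <= (4 * j%:R + 1) * r <= 1 by apply/andP; split; lra.
have zx : z (clamp01 (4 * j%:R * r)) = 0.
  by rewrite /z clamp01_id// mulfK ?gt_eqF// tent_even// mulr0.
have zy : z (clamp01 ((4 * j%:R + 1) * r)) = dl * w r.
  by rewrite /z clamp01_id// mulfK ?gt_eqF// tent_odd mulr1.
have z0 : z (clamp01 0) = 0.
  by rewrite /z clamp01_id ?lexx ?ler01// mul0r -(mulr0 4) (@tent_even _ N 0) ?mulr0.
have Lj : L * (4 * j%:R * r) <= rho / 8.
  rewrite -lL mulrC; apply: ler_pM => //; by rewrite lerDl.
have px : `|p (clamp01 (4 * j%:R * r)) - p (clamp01 0)| <= rho / 8.
  apply: (le_trans (pL _ _)); rewrite !clamp01_id ?lexx ?ler01// subr0.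
  by rewrite ger0_norm.
have py : `|p (clamp01 ((4 * j%:R + 1) * r)) - p (clamp01 (4 * j%:R * r))| <= L * r.
  apply: (le_trans (pL _ _)); rewrite !clamp01_id// mulrDl addrC addKr mul1r.
  by rewrite gtr0_norm.
move: (gh' (clamp01 (4 * j%:R * r))) (gh' (clamp01 ((4 * j%:R + 1) * r))).
move: (gh' (clamp01 0)) px py; rewrite /g0 zx zy z0.
move=> /ler_normlP[? ?] /ler_normlP[? ?] /ler_normlP[? ?].
move=> /ler_normlP[? ?] /ler_normlP[? ?]; split; first by rewrite ler_norml; lra.
by lra.
Unshelve. all: end_near.
Qed.

End little_space_wiggly.

(** * Spectra for a concave modulus *)

Section concave_modulus_graphs.
Context {R : realType} (omega : modulus R) (conc : concave_on01 omega).
Context (eta : R) (omega_eta : log_ratio omega t @[t --> 0^'+] --> eta).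
Implicit Types (f : {i01 R} -> R) (theta s : R).

Local Notation w t := (fine (omega t)).

(** Below some [d], [w t <= t ^ s]; above it, [w t <= w 1 <= w 1 / d ^ s * t ^ s]. *)
Lemma C_omega_holder f s : C_omega omega f -> 0 <= s -> s < eta ->
  exists2 K, 0 <= K &
    forall x y, `|f x - f y| <= K * `|x%:num - y%:num| `^ s.
Proof.
move=> /(C_omega_bound conc)[K K0 fK] s0 s_eta.
have es : 0 < eta - s by rewrite subr_gt0.
have [d /= d0 Hd] := modulus_log_ratio conc omega_eta es.
have ds0 : 0 < d `^ s by exact: powR_gt0.
have w1 : 0 < w 1 by rewrite modulus_fine_gt0// ltr01 lexx.
have C0 : 0 <= 1 + w 1 / d `^ s by rewrite addr_ge0// divr_ge0// ltW.
exists (K * (1 + w 1 / d `^ s)); first by rewrite mulr_ge0.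
move=> x y; apply: (le_trans (fK x y)); rewrite -mulrA ler_wpM2l//.
have [->|/eqP xy] := eqVneq x y.
  by rewrite subrr normr0 modulus_fine0 mulr_ge0// powR_ge0.
have /andP[] := dist01P xy; move: `|_| => t t0 t1.
have ts0 : 0 <= t `^ s by exact: powR_ge0.
have [td|dt] := ltP t d.
  have /andP[_] : t `^ (eta + (eta - s)) <= w t <= t `^ (eta - (eta - s)).
    by apply: Hd => //=; rewrite sub0r normrN gtr0_norm.
  rewrite subKr => /le_trans; apply; rewrite mulrDl mul1r lerDl.
  by rewrite mulr_ge0// divr_ge0// ltW.
apply: (@le_trans _ _ (w 1)); first by rewrite modulus_fine_nd// ltW.
rewrite mulrDl mul1r ler_wpDl// mulrAC ler_pdivlMr// ler_wpM2l ?(ltW w1)//.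
by apply: ge0_ler_powR; rewrite ?nnegrE ?(ltW d0) ?(ltW t0).
Qed.

(** Hölder exponents are only available below [eta]: the exponent [m - e * (1 - theta)] costs
    exactly [e] in the dimension, and [e] is arbitrary. *)
Lemma assouad_spectrum_C_omega_le f theta m : C_omega omega f ->
  0 < theta < 1 -> 0 < m <= 1 -> m <= eta ->
  (assouad_spectrum theta (graph f) <= (1 + (1 - m) / (1 - theta))%:E)%E.
Proof.
move=> fC t01 /andP[m0 m1] m_eta; have /andP[_ t1] := t01.
have t1' : 0 < 1 - theta by rewrite subr_gt0.
apply/lee_addgt0Pr => e e0; pose s := Num.max 0 (m - e * (1 - theta)).
have sm : s < m by rewrite gt_max m0 ltrBlDr ltrDl mulr_gt0.
have s0 : 0 <= s by rewrite le_max lexx.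
have [K K0 fK] := C_omega_holder fC s0 (lt_le_trans sm m_eta).
have s01 : 0 <= s <= 1 by rewrite s0 (le_trans (ltW sm)).
apply: (le_trans (assouad_spectrum_holder_le t01 s01 K0 fK)).
rewrite -EFinD lee_fin -addrA lerD2l.
rewrite -[e](@mulfK _ (1 - theta)) ?gt_eqF// -mulrDl ler_pM2r ?invr_gt0//.
have : m - e * (1 - theta) <= s by rewrite le_max lexx orbT.
by lra.
Qed.

Lemma assouad_spectrum_C_omega_eq1 f theta : 1 <= eta -> C_omega omega f ->
  0 < theta < 1 -> assouad_spectrum theta (graph f) = 1%:E.
Proof.
move=> eta1 fC t01; apply/eqP; rewrite eq_le; apply/andP; split.
  have := assouad_spectrum_C_omega_le fC t01 _ eta1.
  by rewrite subrr mul0r addr0 ltr01 lexx; exact.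
exact: assouad_spectrum_ge1 t01 (C_omega_continuous conc fC).
Qed.

(** The upper bounds hold for every function of the space; only the lower bound uses that [f] is
    wiggly at arbitrarily small scales. *)
Lemma typical_assouad_spectrum : eta < 1 ->
  typical (fun f : little_space omega =>
    forall theta : R, 0 < theta < 1 ->
      (theta <= eta ->
        assouad_spectrum theta (graph f)
          = (2 - (eta - theta) / (1 - theta))%:E) /\
      (eta < theta -> assouad_spectrum theta (graph f) = 2%:E)).
Proof.
move=> eta1.
apply: (@typical_of_dense R (little_space omega)
  (fun n => [set f | wiggly eta n.+1%:R^-1 (little_fun f)])).
  move=> n f e e0; have nu0 : 0 < n.+1%:R^-1 :> R by rewrite invr_gt0 ltr0n.
  have [g [d [d0 fg gd]]] := wiggly_dense conc omega_eta eta1 f e0 nu0.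
  by exists g, d; split.
move=> f fw theta t01; have /andP[t0 t1] := t01.
have H := assouad_spectrum_wiggly_ge eta1 t01 fw; split=> [t_eta|eta_t].
  have -> : 2 - (eta - theta) / (1 - theta) = 1 + (1 - eta) / (1 - theta).
    by field; rewrite gt_eqF// subr_gt0.
  apply/eqP; rewrite eq_le; apply/andP; split; last first.
    by move: H; rewrite (max_idPl t_eta).
  have [fC _] := little_funP f.
  by apply: assouad_spectrum_C_omega_le => //; rewrite (lt_le_trans t0 t_eta) ltW.
apply/eqP; rewrite eq_le assouad_spectrum_le2//=.
move: H; rewrite (max_idPr (ltW eta_t)) divff ?gt_eqF ?subr_gt0//.
Qed.

End concave_modulus_graphs.

(** * Hölder moduli and the theorem *)

(** Convexity of the power [1 / a], applied to [s ^ a] and [t ^ a], then raised to the power [a]. *)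
Lemma concave_powR (R : realType) (a s t k : R) : 0 < a <= 1 ->
  0 <= s -> 0 <= t -> 0 <= k <= 1 ->
  k * s `^ a + (1 - k) * t `^ a <= (k * s + (1 - k) * t) `^ a.
Proof.
move=> /andP[a0 a1] s0 t0 /andP[k0 k1].
have p1 : 1 <= a^-1 by rewrite invf_ge1.
have := @convex_powR R _ p1 (Itv01 k0 k1) (s `^ a) (t `^ a).
rewrite !inE /= !in_itv/= !powR_ge0 => /(_ isT isT).
rewrite !convRE/= -!powRrM mulfV ?gt_eqF// !powRr1// => h.
have u0 : 0 <= k * s `^ a + (1 - k) * t `^ a.
  by rewrite addr_ge0// mulr_ge0 ?powR_ge0// subr_ge0.
have := ge0_ler_powR (ltW a0) _ _ h.
rewrite -powRrM mulVf ?gt_eqF// powRr1//; apply.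
- by rewrite nnegrE powR_ge0.
- by rewrite nnegrE addr_ge0// mulr_ge0// subr_ge0.
Qed.

Lemma log_ratio_holder (R : realType) (a : R) (a0 : 0 < a) :
  log_ratio (holder_modulus a0) t @[t --> 0^'+] --> a.
Proof.
suff H : \forall t \near 0^'+, a = log_ratio (holder_modulus a0) t.
  exact: cvg_trans (near_eq_cvg H) (cvg_cst a).
near=> t.
have t0 : 0 < t by near: t; exact: nbhs_right_gt.
have t1 : t < 1 by near: t; exact: nbhs_right_lt.
by rewrite /log_ratio /= ln_powR mulfK// lt_eqF// ln_lt0// t0.
Unshelve. all: end_near.
Qed.

Theorem theorem2p3 (R : realType) :
  (forall (omega : modulus R) (eta : R),
    concave_on01 omega ->
    log_ratio omega t @[t --> 0^'+] --> eta ->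
    (1 <= eta ->
      forall f : {i01 R} -> R, C_omega omega f ->
      forall theta : R, 0 < theta < 1 ->
        assouad_spectrum theta (graph f) = 1%:E) /\
    (eta < 1 ->
      typical (fun f : little_space omega =>
        forall theta : R, 0 < theta < 1 ->
          (theta <= eta ->
            assouad_spectrum theta (graph f)
              = (2 - (eta - theta) / (1 - theta))%:E) /\
          (eta < theta -> assouad_spectrum theta (graph f) = 2%:E)))) /\
  (forall (alpha : R) (alpha0 : 0 < alpha), alpha < 1 ->
    log_ratio (holder_modulus alpha0) t @[t --> 0^'+] --> alpha /\
    typical (fun f : little_space (holder_modulus alpha0) =>
      forall theta : R, 0 < theta < 1 ->
        (theta <= alpha ->
          assouad_spectrum theta (graph f)
            = (2 - (alpha - theta) / (1 - theta))%:E) /\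
        (alpha < theta -> assouad_spectrum theta (graph f) = 2%:E))).
Proof.
split=> [omega eta conc omega_eta|a a0 a1].
  split=> [eta1 f fC theta|]; last exact: typical_assouad_spectrum.
  exact: (assouad_spectrum_C_omega_eq1 conc omega_eta).
split; first exact: log_ratio_holder.
apply: (typical_assouad_spectrum _ _ a1); last exact: log_ratio_holder.
move=> s t k /andP[s0 _] /andP[t0 _] k01.
rewrite /= -!EFinM -EFinD lee_fin; apply: concave_powR => //.
by rewrite a0 ltW.
Qed.
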